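(* Over $m$ arc additions, topological search spends $\mathrm{O}(n^{5/2})$ total time.
   Context: Incremental setting: $n$ fixed vertices, initially no arcs; distinct arcs are added one at a time ($m$ in total) and processing stops after the addition that creates a cycle, if any. Vertices are numbered by a bijection $\mathit{position}$ onto $\{1,\dots,n\}$ with inverse array $\mathit{vertex}$ (initially arbitrary), maintained as a topological numbering; the graph is an adjacency matrix, so testing/adding an arc takes $\mathrm{O}(1)$. Queues support inject (append) and pop (remove front). When arc $(v,w)$ is added: if $\mathit{position}(v)<\mathit{position}(w)$ nothing is done. Otherwise topological search: $F=[w]$, $B=[v]$, $i=\mathit{position}(w)$, $j=\mathit{position}(v)$, $\mathit{vertex}(i)=\mathit{vertex}(j)=$ null. Repeat: $i=i+1$; while $i<j$ and no $u\in F$ has an arc $(u,\mathit{vertex}(i))$, $i=i+1$; if $i=j$ stop, else inject $\mathit{vertex}(i)$ into $F$ and set $\mathit{vertex}(i)=$ null; $j=j-1$; while $i<j$ and no $z\in B$ has an arc $(\mathit{vertex}(j),z)$, $j=j-1$; if $i=j$ stop, else inject $\mathit{vertex}(j)$ into $B$ and set $\mathit{vertex}(j)=$ null. Cycle test: report a cycle iff some arc $(u,z)$ has $u\in F$, $z\in B$. Otherwise reorder from the final $F,B,i,j$: while $F$ nonempty: if $\mathit{vertex}(i)\ne$ null and some $u$ currently in $F$ has an arc to $\mathit{vertex}(i)$, inject $\mathit{vertex}(i)$ into $F$ and set $\mathit{vertex}(i)=$ null; if $\mathit{vertex}(i)=$ null, pop $x$ from $F$, set $\mathit{vertex}(i)=x$,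 $\mathit{position}(x)=i$; $i=i+1$. While $B$ nonempty: $j=j-1$; if $\mathit{vertex}(j)\ne$ null and it has an arc to some $z$ currently in $B$, inject $\mathit{vertex}(j)$ into $B$ and set $\mathit{vertex}(j)=$ null; if $\mathit{vertex}(j)=$ null, pop $y$ from $B$, set $\mathit{vertex}(j)=y$, $\mathit{position}(y)=j$. *)

(* Defs.v *)
From mathcomp Require Import all_boot all_order all_algebra.
From mathcomp Require Import reals exp.

Set Implicit Arguments.
Unset Strict Implicit.
Unset Printing Implicit Defensive.

(* [Some (t, x)]: the computation ends after [t] primitive operations with
   value [x].  [None]: it did not end within the given fuel, or it used a null
   entry as a vertex.  A run is charged only through [op], one unit for each
   primitive operation: a comparison, an increment, an array read or write, an
   inject, a pop, a look-up or update of the adjacency matrix. *)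
Definition timed (A : Type) : Type := option (nat * A).

Definition ret {A : Type} (x : A) : timed A := Some (0, x).

Definition op {A : Type} (x : A) : timed A := Some (1, x).

Definition bind {A B : Type} (c : timed A) (f : A -> timed B) : timed B :=
  if c is Some (s, x) then
    if f x is Some (t, y) then Some (s + t, y) else None
  else None.

Notation "x <~ c ;; d" := (bind c (fun x => d))
  (at level 100, c at level 99, right associativity,
   format "'[v' x  <~  c ;; '/' d ']'").

Notation "' p <~ c ;; d" := (bind c (fun x => let: p := x in d))
  (at level 100, p strict pattern, c at level 99, right associativity,
   format "'[v' ' p  <~  c ;; '/' d ']'").

(* Iterates [body] as long as the boolean it returns is true.  The fuel bounds
   the number of iterations; the outcome, once it is not [None], does not
   depend on it. *)
Fixpoint loop {S : Type} (fuel : nat) (body : S -> timed (bool * S)) (s : S)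
    : timed S :=
  if fuel is k.+1 then
    '(continue, s') <~ body s ;;
    if continue then loop k body s' else ret s'
  else None.

(* Whether some member of the queue passes the test.  The whole queue is
   traversed, so that this is at least the cost of a scan with early exit. *)
Fixpoint scan {V : Type} (test : V -> timed bool) (q : seq V) : timed bool :=
  if q is x :: q' then
    b <~ test x ;;
    c <~ scan test q' ;;
    ret (b || c)
  else op false.

(* Only the entries 1, ..., n are used; null is [None]. *)
Definition array (V : Type) : Type := nat -> option V.

Definition set_entry {V : Type} (a : array V) (i : nat) (o : option V)
    : array V :=
  fun k => if k == i then o else a k.

(* inject a(i) into q; a(i) := null *)
Definition inject_entry {V : Type} (a : array V) (i : nat) (q : seq V)
    : timed (seq V * array V) :=
  o <~ op (a i) ;;
  if o is Some x then
    q <~ op (rcons q x) ;;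
    a <~ op (set_entry a i None) ;;
    ret (q, a)
  else None.

Record numbering (n : nat) := Numbering {
  position : 'I_n -> nat;
  vertex : array 'I_n
}.

(* [position] is injective into {1, ..., n}, hence a bijection onto it, and
   [vertex] is its inverse. *)
Definition valid_numbering {n : nat} (N : numbering n) : Prop :=
  (forall x, 1 <= position N x <= n) /\
  (forall x i, vertex N i = Some x <-> position N x = i).

Definition set_position {n : nat} (p : 'I_n -> nat) (x : 'I_n) (i : nat)
    : 'I_n -> nat :=
  fun y => if y == x then i else p y.

Section TopologicalSearch.

Variables (n : nat) (arc : rel 'I_n) (fuel : nat).

Definition arc_from_queue (F : seq 'I_n) (o : option 'I_n) : timed bool :=
  scan (fun u => op (if o is Some x then arc u x else false)) F.

Definition arc_to_queue (o : option 'I_n) (B : seq 'I_n) : timed bool :=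
  scan (fun z => op (if o is Some x then arc x z else false)) B.

(* while i < j and no u in F has an arc (u, a(i)): i := i + 1 *)
Definition advance (F : seq 'I_n) (a : array 'I_n) (j i : nat) : timed nat :=
  loop fuel (fun i =>
    lt_ij <~ op (i < j) ;;
    if lt_ij then
      o <~ op (a i) ;;
      hit <~ arc_from_queue F o ;;
      if hit then ret (false, i) else
      i <~ op i.+1 ;;
      ret (true, i)
    else ret (false, i)) i.

(* while i < j and no z in B has an arc (a(j), z): j := j - 1 *)
Definition retreat (B : seq 'I_n) (a : array 'I_n) (i j : nat) : timed nat :=
  loop fuel (fun j =>
    lt_ij <~ op (i < j) ;;
    if lt_ij then
      o <~ op (a j) ;;
      hit <~ arc_to_queue o B ;;
      if hit then ret (false, j) else
      j <~ op j.-1 ;;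
      ret (true, j)
    else ret (false, j)) j.

Record search_state := SearchState {
  forward_queue : seq 'I_n;
  backward_queue : seq 'I_n;
  low : nat;
  high : nat;
  entries : array 'I_n
}.

Definition search_round (s : search_state) : timed (bool * search_state) :=
  let: SearchState F B i j a := s in
  i <~ op i.+1 ;;
  i <~ advance F a j i ;;
  met <~ op (i == j) ;;
  if met then ret (false, SearchState F B i j a) else
  '(F, a) <~ inject_entry a i F ;;
  j <~ op j.-1 ;;
  j <~ retreat B a i j ;;
  met <~ op (i == j) ;;
  if met then ret (false, SearchState F B i j a) else
  '(B, a) <~ inject_entry a j B ;;
  ret (true, SearchState F B i j a).

Definition search (N : numbering n) (v w : 'I_n) : timed search_state :=
  i <~ op (position N w) ;;
  j <~ op (position N v) ;;
  F <~ op [:: w] ;;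
  B <~ op [:: v] ;;
  a <~ op (set_entry (vertex N) i None) ;;
  a <~ op (set_entry a j None) ;;
  loop fuel search_round (SearchState F B i j a).

Definition cycle_test (F B : seq 'I_n) : timed bool :=
  scan (fun u => scan (fun z => op (arc u z)) B) F.

(* if vertex(i) = null: pop x from q; vertex(i) := x; position(x) := i *)
Definition fill (i : nat) (q : seq 'I_n) (N : numbering n)
    : timed (seq 'I_n * numbering n) :=
  o <~ op (vertex N i) ;;
  if o is Some _ then ret (q, N) else
  if q is x :: q' then
    q <~ op q' ;;
    a <~ op (set_entry (vertex N) i (Some x)) ;;
    p <~ op (set_position (position N) x i) ;;
    ret (q, Numbering p a)
  else None.

Definition reorder_forward (F : seq 'I_n) (i : nat) (N : numbering n)
    : timed (seq 'I_n * nat * numbering n) :=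
  loop fuel (fun s =>
    let: (F, i, N) := s in
    empty <~ op (nilp F) ;;
    if empty then ret (false, (F, i, N)) else
    o <~ op (vertex N i) ;;
    hit <~ (if o is Some _ then arc_from_queue F o else ret false) ;;
    '(F, a) <~ (if hit then inject_entry (vertex N) i F
                else ret (F, vertex N)) ;;
    '(F, N) <~ fill i F (Numbering (position N) a) ;;
    i <~ op i.+1 ;;
    ret (true, (F, i, N))) (F, i, N).

Definition reorder_backward (B : seq 'I_n) (j : nat) (N : numbering n)
    : timed (seq 'I_n * nat * numbering n) :=
  loop fuel (fun s =>
    let: (B, j, N) := s in
    empty <~ op (nilp B) ;;
    if empty then ret (false, (B, j, N)) else
    j <~ op j.-1 ;;
    o <~ op (vertex N j) ;;
    hit <~ (if o is Some _ then arc_to_queue o B else ret false) ;;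
    '(B, a) <~ (if hit then inject_entry (vertex N) j B
                else ret (B, vertex N)) ;;
    '(B, N) <~ fill j B (Numbering (position N) a) ;;
    ret (true, (B, j, N))) (B, j, N).

(* The value is [None] when a cycle is reported, and otherwise the new
   numbering. *)
Definition topological_search (N : numbering n) (v w : 'I_n)
    : timed (option (numbering n)) :=
  ordered <~ op (position N v < position N w) ;;
  if ordered then ret (Some N) else
  '(SearchState F B i j a) <~ search N v w ;;
  cyclic <~ cycle_test F B ;;
  if cyclic then ret None else
  '(_, _, N) <~ reorder_forward F i (Numbering (position N) a) ;;
  '(_, _, N) <~ reorder_backward B j N ;;
  ret (Some N).

End TopologicalSearch.

Definition arc_rel {n : nat} (arcs : seq ('I_n * 'I_n)) : rel 'I_n :=
  fun u v => (u, v) \in arcs.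

(* Adds the arcs of [todo] in turn to a graph whose arcs are those of [added],
   and halts when a cycle is reported. *)
Fixpoint add_arcs {n : nat} (fuel : nat) (added todo : seq ('I_n * 'I_n))
    (N : numbering n) : timed (option (numbering n)) :=
  if todo is (v, w) :: todo' then
    added <~ op (rcons added (v, w)) ;;
    r <~ topological_search (arc_rel added) fuel N v w ;;
    if r is Some N' then add_arcs fuel added todo' N' else ret None
  else ret (Some N).

(* [cycle] is the library's notion of a closed path, which allows [::]. *)
Definition acyclic {T : eqType} (e : rel T) : Prop :=
  forall c : seq T, cycle e c -> c = [::].

(* Distinct arcs without loops, of which only the last may create a cycle. *)
Definition incremental {n : nat} (arcs : seq ('I_n * 'I_n)) : Prop :=
  [/\ uniq arcs,
      all (fun a => a.1 != a.2) arcs &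
      forall k, k < size arcs -> acyclic (arc_rel (take k arcs))].

(* Starting from [N] and the graph without arcs, the successive additions end,
   after [t] primitive operations in total. *)
Definition total_time {n : nat} (N : numbering n) (arcs : seq ('I_n * 'I_n))
    (t : nat) : Prop :=
  exists fuel r, add_arcs fuel [::] arcs N = Some (t, r).

(* Main.v *)
Require Import Defs.
From mathcomp Require Import all_boot all_order all_algebra.
From mathcomp Require Import reals exp.
From mathcomp Require Import zify lra.

Set Implicit Arguments.
Unset Strict Implicit.
Unset Printing Implicit Defensive.

(* Suppose that a search triggered by the arc [(v, w)] ends at the slot [c]
   with queues [F] and [B].  Its time is bounded by [D + |F| |B|] up to a
   constant factor, where [D] is the sum of the distances from the slots of the
   members of [F] and [B] to [c]: while the reordering passes over a slot, the
   length of the queue is the number of null slots still ahead.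

   Every [z] in [B] now reaches every [u] in [F], which it did not before since
   [u] preceded [z].  Hence the products [|F| |B|] add up to at most [n ^ 2].

   To bound the sum of the [D]s, let [p] be the numbering at the end of the run,
   and let [S] be the sum over all vertices [x] of [position x * p x], which
   never exceeds [n ^ 3].  Vertices that move up are reachable from [w], hence
   have [p x >= p w]; those that move down reach [v], hence have [p x <= p v].
   As the displacements add up to [0], a member of [F] with [p u >= p v + T] or
   of [B] with [p z <= p w - T] contributes at least [T] times its share of [D]
   to the increase of [S].  The other members contribute at most [n] each to
   [D]; there are such members in [F] if and only if there are in [B], and each
   pair of them is newly connected with a gap smaller than [2 T] in [p].  At
   most [2 T n] pairs ever have such a gap, so that the [D]s add up to
   [O(n ^ 3 / T + n ^ 2 T)], and [T] is chosen close to the square root of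
   [n].  The last search, which may create a cycle, takes [O(n ^ 2)] time. *)

(** * Running timed computations *)

Definition outcome {A : Type} (c : timed A) (P : nat -> A -> Prop) : Prop :=
  if c is Some (t, x) then P t x else False.

Arguments bind : simpl never.
Arguments outcome : simpl never.

Lemma outcome_ret (A : Type) (x : A) (P : nat -> A -> Prop) :
  P 0 x -> outcome (ret x) P.
Proof. by []. Qed.

Lemma outcome_val (A : Type) s (x : A) (P : nat -> A -> Prop) :
  P s x -> outcome (Some (s, x)) P.
Proof. by []. Qed.

Lemma outcome_bind (A B : Type) (c : timed A) (f : A -> timed B) P :
  outcome c (fun s x => outcome (f x) (fun t y => P (s + t) y)) ->
  outcome (bind c f) P.
Proof. by rewrite /outcome /bind; case: c => [[s x]|] //=; case: (f x) => [[t y]|]. Qed.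

Lemma outcome_op_bind (A B : Type) (x : A) (f : A -> timed B) P :
  outcome (f x) (fun t => P t.+1) -> outcome (bind (op x) f) P.
Proof. by move=> H; apply: outcome_bind. Qed.

Lemma outcome_imp (A : Type) (c : timed A) (P Q : nat -> A -> Prop) :
  outcome c P -> (forall t x, P t x -> Q t x) -> outcome c Q.
Proof. by rewrite /outcome; case: c => [[t x]|] //= H; apply. Qed.

Lemma outcome_seq (A B : Type) (c : timed A) (f : A -> timed B) P Q :
  outcome c P ->
  (forall s x, P s x -> outcome (f x) (fun t y => Q (s + t) y)) ->
  outcome (bind c f) Q.
Proof. by move=> cP H; apply: outcome_bind; apply: outcome_imp cP H. Qed.

Lemma outcomeW (A : Type) (c : timed A) P :
  outcome c P -> exists t x, c = Some (t, x) /\ P t x.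
Proof. by rewrite /outcome; case: c => [[t x]|] //= H; exists t, x. Qed.

Lemma loopS (S : Type) k (body : S -> timed (bool * S)) s :
  loop k.+1 body s =
  ('(continue, s') <~ body s ;; if continue then loop k body s' else ret s').
Proof. by []. Qed.

Lemma scan_op (V : Type) (f : pred V) (q : seq V) :
  scan (fun x => op (f x)) q = Some ((size q).+1, has f q).
Proof. by elim: q => //= x q ->; rewrite /bind /= !add1n addn0. Qed.

Definition hits {n : nat} (arc : rel 'I_n) (Q : seq 'I_n) (o : option 'I_n) :=
  if o is Some x then has (arc^~ x) Q else false.

Lemma arc_from_queueE n (arc : rel 'I_n) Q o :
  arc_from_queue arc Q o = Some ((size Q).+1, hits arc Q o).
Proof.
rewrite /arc_from_queue scan_op; case: o => [x|] //=.
by rewrite has_pred0.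
Qed.

(** Through the converse, the backward half of the algorithm becomes an instance of what is shown
    for the forward half. *)
Definition converse {T : Type} (e : rel T) : rel T := fun x y => e y x.

Lemma arc_to_queueE n (arc : rel 'I_n) o Q :
  arc_to_queue arc o Q = Some ((size Q).+1, hits (converse arc) Q o).
Proof. exact: (arc_from_queueE (converse arc) Q o). Qed.

(** * Scanning the slots for the next neighbour of a queue *)

Section Sweep.

Variables (V : Type) (a : array V) (more : pred nat) (next : nat -> nat).
Variables (cost : nat) (hit : pred (option V)) (test : option V -> timed bool).
Hypothesis testE : forall o, test o = Some (cost, hit o).

(** Common form of [advance] and [retreat], so that one induction serves both directions. *)
Definition sweep (fuel : nat) : nat -> timed nat :=
  loop fuel (fun k =>
    b <~ op (more k) ;;
    if b then
      o <~ op (a k) ;;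
      h <~ test o ;;
      if h then ret (false, k) else
      k <~ op (next k) ;;
      ret (true, k)
    else ret (false, k)).

(** Here [d] is the number of steps after which the guard fails, and a full iteration costs the test
    and three more operations. *)
Lemma sweepP fuel d k :
  d < fuel -> (forall l, l <= d -> more (iter l next k) = (l < d)) ->
  outcome (sweep fuel k) (fun t k' => exists l,
    [/\ l <= d, k' = iter l next k,
        forall l', l' < l -> ~~ hit (a (iter l' next k)),
        (l == d) || hit (a k') & t <= l.+1 * (cost + 3)]).
Proof.
rewrite /sweep; elim: fuel d k => [|fuel IH] d k // d_fuel moreE.
rewrite loopS; apply: outcome_bind; apply: outcome_op_bind.
have := moreE 0 isT => /= ->.
case: d d_fuel moreE => [|d] d_fuel moreE /=.
  by do 2!apply: outcome_ret; exists 0; split=> //; lia.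
apply: outcome_op_bind; rewrite testE; apply: outcome_bind; apply: outcome_val.
case hk: (hit (a k)) => /=.
  by do 2!apply: outcome_ret; exists 0; split=> //; lia.
apply: outcome_op_bind; apply: outcome_ret.
have {}IH := IH d (next k) _ _; apply: outcome_imp.
  apply: IH => // l l_d; rewrite -iterSr moreE //.
move=> t k' [l [l_d -> no_hit last_hit t_le]].
exists l.+1; split=> //.
- by rewrite -iterSr.
- by case=> [|l'] l'_l; rewrite ?hk // iterSr no_hit.
- by lia.
Qed.

End Sweep.

Lemma advanceP n (arc : rel 'I_n) fuel F a j i :
  i <= j -> j - i < fuel ->
  outcome (advance arc fuel F a j i) (fun t i' =>
    [/\ i <= i' <= j, forall k, i <= k < i' -> ~~ hits arc F (a k),
        (i' == j) || hits arc F (a i') & t <= (i'.+1 - i) * (size F + 4)]).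
Proof.
move=> ij fuelP.
rewrite -[advance _ _ _ _ _ _]/(sweep a (fun k => k < j) succn
                                      (arc_from_queue arc F) fuel i).
have iterE l k : iter l succn k = l + k by elim: l => //= l ->.
apply: outcome_imp (sweepP (d := j - i) _ (arc_from_queueE arc F) fuelP _) _.
  by move=> l; rewrite iterE; lia.
move=> t _ [l [l_d -> no_hit last_hit t_le]]; rewrite iterE in last_hit *.
split; last by apply: leq_trans t_le _; rewrite leq_mul //; lia.
- by lia.
- move=> k k_i; have := no_hit (k - i); rewrite iterE subnK; last by lia.
  by apply; lia.
- by case/orP: last_hit => [/eqP l_j|->]; rewrite ?orbT //; apply/orP; left; lia.
Qed.

Lemma retreatP n (arc : rel 'I_n) fuel B a i j :
  i <= j -> j - i < fuel ->
  outcome (retreat arc fuel B a i j) (fun t j' =>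
    [/\ i <= j' <= j, forall k, j' < k <= j -> ~~ hits (converse arc) B (a k),
        (i == j') || hits (converse arc) B (a j') &
        t <= (j.+1 - j') * (size B + 4)]).
Proof.
move=> ij fuelP.
rewrite -[retreat _ _ _ _ _ _]/(sweep a (fun k => i < k) predn
                                      (arc_to_queue arc ^~ B) fuel j).
have iterE l k : iter l predn k = k - l by elim: l => [|l] /=; lia.
apply: outcome_imp (sweepP (d := j - i) _ (fun o => arc_to_queueE arc o B) fuelP _) _.
  by move=> l; rewrite iterE; lia.
move=> t _ [l [l_d -> no_hit last_hit t_le]]; rewrite iterE in last_hit *.
split; last by apply: leq_trans t_le _; rewrite leq_mul //; lia.
- by lia.
- move=> k k_j; have := no_hit (j - k); rewrite iterE subKn; last by lia.
  by apply; lia.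
- by case/orP: last_hit => [/eqP l_j|->]; rewrite ?orbT //; apply/orP; left; lia.
Qed.

(** * Refilling the null slots *)

Definition null {V : Type} (a : array V) : pred nat := fun k => ~~ isSome (a k).

Section Place.

Variables (n : nat) (arc : rel 'I_n).

(** The work at one slot that both reordering loops share. The continuation [next] is needed because
    only the forward loop still has to move its index afterwards. *)
Definition place {A : Type} (test : seq 'I_n -> option 'I_n -> timed bool)
    (Q : seq 'I_n) (i : nat) (N : numbering n)
    (next : seq 'I_n * numbering n -> timed A) : timed A :=
  o <~ op (vertex N i) ;;
  hit <~ (if o is Some _ then test Q o else ret false) ;;
  '(Q, a) <~ (if hit then inject_entry (vertex N) i Q
              else ret (Q, vertex N)) ;;
  x <~ fill i Q (Numbering (position N) a) ;;
  next x.

(** [Filled] merges the two cases in which a vertex is popped: the slot was null, or its occupant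
    [s] was first injected. *)
Inductive placed (Q : seq 'I_n) (i : nat) (N : numbering n) :
    seq 'I_n -> numbering n -> Prop :=
| Kept s of vertex N i = Some s & ~~ has (arc^~ s) Q : placed Q i N Q N
| Filled h Q' a of (if vertex N i is Some s then
                      has (arc^~ s) Q /\ rcons Q s = h :: Q'
                    else Q = h :: Q')
    & (forall k, a k = if k == i then Some h else vertex N k) :
  placed Q i N Q' (Numbering (set_position (position N) h i) a).

(** The cost depends on the branch taken, so the postcondition is required of every cost in a window
    that covers all branches; the longest one makes [size Q + 9] operations. *)
Lemma placeP (A : Type) test Q i N (next : seq 'I_n * numbering n -> timed A) P :
  (forall Q o, test Q o = Some ((size Q).+1, hits arc Q o)) ->
  Q != [::] ->
  (forall Q' N', placed Q i N Q' N' ->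
     outcome (next (Q', N'))
       (fun t x => forall k, t <= k <= size Q + 9 + t -> P k x)) ->
  outcome (place test Q i N next) P.
Proof.
case: N => p a testE Q_neq0 H; rewrite /place; apply: outcome_op_bind => /=.
case ai: (a i) => [s|]; last first.
  do 2!(apply: outcome_bind; apply: outcome_ret).
  apply: outcome_bind; apply: outcome_op_bind; rewrite /= ai.
  case: Q Q_neq0 H => // h Q _ H; do 3!apply: outcome_op_bind; apply: outcome_ret.
  have {}H := H Q _ (@Filled _ _ _ h Q (set_entry a i (Some h)) _ _).
  by apply: outcome_imp (H _ _) _ => //= [|t x]; [rewrite ai | apply; lia].
rewrite testE; apply: outcome_bind; apply: outcome_val => /=.
case hit: (has _ Q); last first.
  apply: outcome_bind; apply: outcome_ret.
  apply: outcome_bind; apply: outcome_op_bind; rewrite /= ai; apply: outcome_ret.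
  have {}H := H _ _ (@Kept Q i (Numbering p a) s ai (negbT hit)).
  by apply: outcome_imp H _ => /= t x; apply; lia.
rewrite /inject_entry; apply: outcome_bind; apply: outcome_op_bind; rewrite ai.
do 2!apply: outcome_op_bind; apply: outcome_ret.
apply: outcome_bind; apply: outcome_op_bind; rewrite /= {1}/set_entry eqxx.
case Qs: (rcons Q s) => [|h Q']; first by case: (Q) Qs.
do 3!apply: outcome_op_bind; apply: outcome_ret.
have {}H := H Q' _ (@Filled _ _ _ h Q'
              (set_entry (set_entry a i None) i (Some h)) _ _).
apply: outcome_imp (H _ _) _ => //= [||t x].
- by rewrite ai.
- by move=> k; rewrite /set_entry; case: eqP.
- by apply; lia.
Qed.

End Place.

(** This is the sum of the queue lengths over a pass along [L], since the queue always has as many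
    members as there are null slots ahead. *)
Fixpoint null_weight {V : Type} (a : array V) (L : seq nat) : nat :=
  if L is i :: L' then count (null a) L + null_weight a L' else 0.

(** * The invariant of a reordering pass, for either direction *)

Section Refill.

Variables (n : nat) (arc : rel 'I_n) (r : rel nat) (reach : pred 'I_n).
Variables (X Q0 : seq 'I_n) (L0 : seq nat) (N0 : numbering n).
Hypothesis r_asym : forall k l, r k l -> ~~ r l k.
Hypothesis reach_closed : forall x y, reach x -> arc x y -> reach y.

(** The order [r] is [ltn] in the forward pass and [gtn] in the backward one. [L0] lists the slots
    of the whole pass, [L] those still ahead. *)
Record slots (L : seq nat) : Prop := Slots {
  slots_sub : {subset L <= L0};
  slots_range : forall k, k \in L -> 1 <= k <= n;
  slots_uniq : uniq L;
  slots_pairwise : pairwise r L;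
  slots_above : forall k l, 1 <= k <= n -> k \notin L -> l \in L -> r k l
}.

Lemma slots_behead i L : slots (i :: L) -> slots L.
Proof.
case=> sub range /= /andP[_ uL] /andP[/allP iL pL] above; split=> //.
- by move=> k kL; apply: sub; rewrite inE kL orbT.
- by move=> k kL; apply: range; rewrite inE kL orbT.
- move=> k l k_n kL lL; have [->|k_i] := eqVneq k i; first exact: iL.
  by apply: above; rewrite ?inE ?(negbTE k_i) ?lL ?orbT.
Qed.

(** [X] collects vertices that are absent from the array without being queued: [B] during the
    forward pass, none during the backward one. A queued vertex keeps its old position until it is
    popped. *)
Record refilling (L : seq nat) (Q : seq 'I_n) (N : numbering n) : Prop :=
    Refilling {
  refilling_slots : slots L;
  refilling_uniq : uniq Q;
  refilling_inverse : forall k x,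
    vertex N k = Some x <-> [/\ position N x = k, x \notin Q & x \notin X];
  refilling_size : size Q = count (null (vertex N)) L;
  refilling_range : forall x, 1 <= position N x <= n;
  refilling_queue : forall x, x \in Q ->
    [/\ position N x = position N0 x, position N x \notin behead L, reach x,
        x \notin X & (x \in Q0) || (position N0 x \in L0)];
  refilling_moved : forall x, position N x = position N0 x \/
    [/\ r (position N0 x) (position N x), position N x \in L0,
        position N x \notin L, reach x & (x \in Q0) || (position N0 x \in L0)];
  refilling_source : forall x, x \in Q0 -> x \in Q \/ position N x \in L0;
  refilling_excluded : forall x, x \in X -> position N x = position N0 x;
  refilling_frame : forall k, k \notin L0 -> vertex N k = vertex N0 k
}.

(** The queue keeps matching the null slots ahead: a null slot takes one vertex, whereas an occupied
    slot that is refilled gives one and takes one. An injected vertex inherits [reach] from the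
    queue member that hits it, and the old position of the popped vertex is not ahead, so it can
    only move along [r]. *)
Lemma refilling_step i L Q N Q' N' :
  refilling (i :: L) Q N -> placed arc Q i N Q' N' ->
  refilling L Q' N'.
Proof.
case=> sl uQ inv sz rng que mov src exc frm.
have slL := slots_behead sl.
have iL0 : i \in L0 by apply: (slots_sub sl); rewrite mem_head.
have iL : i \notin L by case/andP: (slots_uniq sl).
have i_n : 1 <= i <= n by apply: (slots_range sl); rewrite mem_head.
have nb k : k \notin L -> k \notin behead L.
  by apply: contra => /mem_behead.
case=> [s ai nohit | h Q1 a hQ aE].
  split=> //.
  - by rewrite sz /= /null ai.
  - by move=> x /que [? /nb] /=.
  - move=> x; case: (mov x) => [->|[? ?]]; first by left.
    by rewrite inE => /norP[_ ?]; right.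
(* [S] is the queue just before the pop. *)
pose S := if vertex N i is Some s then rcons Q s else Q.
have SE : S = h :: Q1 by rewrite /S; case: (vertex N i) hQ => [s []|].
have uS : uniq S.
  rewrite /S; case ai: (vertex N i) => [s|] //.
  by have [/(_ ai)[_ sQ _] _] := inv i s; rewrite rcons_uniq sQ.
have memS x : x \in S -> [/\ position N x = position N0 x,
    position N x \notin L, reach x, x \notin X &
    (x \in Q0) || (position N0 x \in L0)].
  rewrite /S; case ai: (vertex N i) hQ => [s|] hQ; last by move/que.
  rewrite mem_rcons inE => /orP[/eqP -> | /que//].
  have [/(_ ai)[ps sQ sX] _] := inv i s.
  have ps0 : position N s = position N0 s.
    by case: (mov s) => // -[_ _]; rewrite ps mem_head.
  rewrite -ps0 ps; split=> //; last by rewrite iL0 orbT.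
  by case: hQ => /hasP[u /que[_ _ ru _ _] us] _; apply: reach_closed us.
have subS x : x \in Q -> x \in S.
  by rewrite /S; case: (vertex N i) => [s|] //; rewrite mem_rcons inE orbC => ->.
have notS x : x \notin S -> x \notin Q by apply: contra; apply: subS.
have hS : h \in S by rewrite SE mem_head.
have [ph0 phL rh hX hQ0] := memS h hS.
have hQ1 : h \notin Q1 by move: uS; rewrite SE => /andP[].
have aL k : k \in L -> a k = vertex N k.
  by move=> kL; rewrite aE; case: eqP => // ki; rewrite -ki kL in iL.
split=> //=.
- by move: uS; rewrite SE => /andP[].
- move=> k x; rewrite aE /set_position; case: (eqVneq k i) => [->|k_i].
    case: (eqVneq x h) => [->|x_h].
      by split=> // _; split.
    split=> [[x_h']|[pxi xQ1 xX]]; first by rewrite x_h' eqxx in x_h.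
    have xS : x \notin S by rewrite SE inE negb_or x_h.
    have ax : vertex N i = Some x by apply/inv; rewrite pxi (notS x xS).
    by case/negP: xS; rewrite /S ax mem_rcons mem_head.
  case: (eqVneq x h) => [->|x_h].
    split=> [/inv[_ hQ' _]|[ki]]; last by rewrite ki eqxx in k_i.
    move: hS hQ; rewrite /S; case: (vertex N i) => [s|].
      move=> _ [/hasP[u uQ' _]]; case: (Q) hQ' uQ' => [|q Q2] // + _ [qh _].
      by rewrite qh mem_head.
    by rewrite (negbTE hQ').
  rewrite inv; split=> -[pxk xQ xX]; split=> //.
    have : x \notin S.
      rewrite /S; case ai: (vertex N i) => [s|] //.
      rewrite mem_rcons inE negb_or xQ andbT; apply/eqP => xs.
      by have [/(_ ai)[psi _ _] _] := inv i s; rewrite -pxk xs psi eqxx in k_i.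
    by rewrite SE inE negb_or => /andP[].
  by apply: notS; rewrite SE inE negb_or x_h.
- have -> : count (null a) L = count (null (vertex N)) L.
    by apply: eq_in_count => k kL; rewrite /null aL.
  have : size S = (size Q1).+1 by rewrite SE.
  rewrite /S; move: sz; rewrite /= /null; case: (vertex N i) => [s|] /= sz.
    by rewrite size_rcons => -[<-].
  by rewrite sz => -[<-].
- by move=> x; rewrite /set_position; case: ifP.
- move=> x xQ1; have xS : x \in S by rewrite SE inE xQ1 orbT.
  have [? /nb ? ? ? ?] := memS x xS.
  by rewrite /set_position; case: eqP => // xh; rewrite -xh xQ1 in hQ1.
- move=> x; rewrite /set_position; case: eqP => [->|_]; last first.
    case: (mov x) => [->|[? ?]]; first by left.
    by rewrite inE => /norP[_ ?]; right.
  have [i_h|i_h] := eqVneq (position N0 h) i; first by left.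
  right; split=> //; apply: (slots_above sl); rewrite ?mem_head //.
    by rewrite -ph0.
  by rewrite inE (negbTE i_h) -ph0.
- move=> x; rewrite /set_position; case: eqP => [->|/eqP x_h]; first by right.
  move/src => [/subS|]; last by right.
  by rewrite SE inE (negbTE x_h) /=; left.
- move=> x xX; rewrite /set_position; case: eqP => [xh|_]; last exact: exc.
  by rewrite -xh xX in hX.
- move=> k kL0; rewrite aE; case: eqP => [ki|_]; last exact: frm.
  by rewrite ki iL0 in kL0.
Qed.

(* The vertices of the queue are regarded as sitting, in the order of the
   queue, just before the slots of [L]; the arcs between vertices outside [X]
   agree with the resulting linear order. *)
Record ordered (L : seq nat) (Q : seq 'I_n) (p : 'I_n -> nat) : Prop := Ordered {
  ordered_settled : forall x y, arc x y -> x \notin X -> y \notin X ->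
    x \notin Q -> y \notin Q -> r (p x) (p y);
  ordered_into : forall x y, arc x y -> x \notin X ->
    x \notin Q -> y \in Q -> p x \notin L;
  ordered_from : forall x y, arc x y -> y \notin X ->
    x \in Q -> y \notin Q -> p y \in L;
  ordered_queue : pairwise (fun x y => ~~ arc y x) Q
}.

(** Filling a slot leaves the linear order as it is: an injected occupant goes last in the queue,
    still before the slots of [L], and the popped vertex comes first. Only a kept occupant changes
    place, from behind the queue to before it, and no queue member has an arc to it. *)
Lemma ordered_step i L Q N Q' N' :
  irreflexive arc ->
  refilling (i :: L) Q N -> placed arc Q i N Q' N' ->
  ordered (i :: L) Q (position N) -> ordered L Q' (position N').
Proof.
move=> irr [sl uQ inv sz rng que mov src exc frm].
have iL : i \notin L by case/andP: (slots_uniq sl).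
case=> [s ai nohit | h Q1 a hQ aE] [set into from_ que_].
  have [/(_ ai)[ps sQ sX] _] := inv i s.
  split=> //.
  - by move=> x y xy xX xQ yQ; have := into x y xy xX xQ yQ; rewrite inE => /norP[].
  - move=> x y xy yX xQ yQ; have := from_ x y xy yX xQ yQ.
    rewrite inE => /orP[/eqP py|//].
    have : vertex N i = Some y by apply/inv.
    rewrite ai => -[sy]; case/negP: nohit; apply/hasP.
    by exists x; rewrite // sy.
pose S := if vertex N i is Some s then rcons Q s else Q.
have SE : S = h :: Q1 by rewrite /S; case: (vertex N i) hQ => [s []|].
have uS : uniq S.
  rewrite /S; case ai: (vertex N i) => [s|] //.
  by have [/(_ ai)[_ sQ _] _] := inv i s; rewrite rcons_uniq sQ.
have XS x : x \in S -> x \notin X.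
  rewrite /S; case ai: (vertex N i) => [s|]; last by case/que.
  rewrite mem_rcons inE => /orP[/eqP ->|]; last by case/que.
  by have [/(_ ai)[_ _ ->] _] := inv i s.
have intoS x y : arc x y -> x \notin X -> x \notin S -> y \in S ->
    position N x \notin i :: L /\ r (position N x) i.
  move=> xy xX xS yS.
  suff pxiL : position N x \notin i :: L.
    by split=> //; apply: (slots_above sl); rewrite ?mem_head.
  move: xS yS; rewrite /S; case ai: (vertex N i) => [s|]; last exact: into.
  have [/(_ ai)[psi sQ sX] _] := inv i s.
  rewrite mem_rcons in_cons negb_or => /andP[x_s xQ].
  rewrite mem_rcons in_cons => /orP[/eqP ys|yQ]; last exact: into yQ.
  (* The occupant was settled before its injection, so an arc into it comes from a slot before
     [i]. *)
  have := set x y xy xX; rewrite ys psi => /(_ sX xQ sQ) /r_asym rxi.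
  apply: contra rxi; rewrite inE => /orP[/eqP pxi|pxL].
    have : vertex N i = Some x by apply/inv.
    by rewrite ai => -[sx]; rewrite sx eqxx in x_s.
  by case/andP: (slots_pairwise sl) => /allP /(_ _ pxL).
have fromS x y : arc x y -> y \notin X -> x \in S -> y \notin S ->
    position N y \in L.
  move=> xy yX xS yS.
  have yQ : y \notin Q.
    apply: contra yS; rewrite /S; case: (vertex N i) => [s|] // yQ.
    by rewrite mem_rcons inE yQ orbT.
  have pyi : position N y != i.
    apply: contraNneq yS => pyi.
    have ai : vertex N i = Some y by apply/inv.
    by rewrite /S ai mem_rcons mem_head.
  suff : position N y \in i :: L by rewrite inE (negbTE pyi).
  move: xS; rewrite /S; case ai: (vertex N i) => [s|] xS; last exact: (from_ x y).
  move: xS; rewrite mem_rcons inE => /orP[/eqP xs|xQ]; last exact: (from_ x y).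
  have [/(_ ai)[psi sQ sX] _] := inv i s; rewrite xs in xy.
  have /r_asym := set s y xy sX yX sQ yQ; rewrite psi.
  by apply: contraNT => pyL; apply: (slots_above sl) => //; rewrite mem_head.
have queS : pairwise (fun x y => ~~ arc y x) S.
  rewrite /S; case ai: (vertex N i) => [s|] //.
  rewrite pairwise_rcons que_ andbT; apply/allP => q qQ; apply/negP => sq.
  have [/(_ ai)[psi sQ sX] _] := inv i s.
  by have := into s q sq sX sQ qQ; rewrite psi mem_head.
have Sh x : x \notin Q1 -> x != h -> x \notin S.
  by move=> xQ1 x_h; rewrite SE inE negb_or x_h.
have subS x : x \notin S -> x \notin Q.
  apply: contra; rewrite /S; case: (vertex N i) => [s|] // xQ.
  by rewrite mem_rcons inE xQ orbT.
have hS : h \in S by rewrite SE mem_head.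
have Q1S x : x \in Q1 -> x \in S by move=> xQ1; rewrite SE inE xQ1 orbT.
have ri k : k \in L -> r i k.
  by case/andP: (slots_pairwise sl) => /allP H _ /H.
split=> /=.
- move=> x y xy xX yX xQ1 yQ1; rewrite /set_position.
  have [xh|x_h] := eqVneq x h; have [yh|y_h] := eqVneq y h.
  + by rewrite xh yh irr in xy.
  + by apply: ri; rewrite xh in xy; apply: fromS xy _ _ _ => //; apply: Sh.
  + by rewrite yh in xy; case: (intoS x h xy xX (Sh x xQ1 x_h) hS).
  + by apply: set => //; apply: subS; apply: Sh.
- move=> x y xy xX xQ1 yQ1; rewrite /set_position.
  have [xh|x_h] := eqVneq x h => //.
  have [+ _] := intoS x y xy xX (Sh x xQ1 x_h) (Q1S y yQ1).
  by rewrite inE => /norP[].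
- move=> x y xy yX xQ1 yQ1; rewrite /set_position.
  have [yh|y_h] := eqVneq y h; last exact: fromS xy yX (Q1S x xQ1) (Sh y yQ1 y_h).
  move: queS; rewrite SE /= => /andP[/allP /(_ x xQ1)].
  by rewrite -yh xy.
- by move: queS; rewrite SE => /andP[].
Qed.

End Refill.

Lemma null_weight_eq (V : Type) (a b : array V) L :
  {in L, a =1 b} -> null_weight a L = null_weight b L.
Proof.
elim: L => //= i L IH ab; rewrite IH; last by move=> k kL; apply: ab; rewrite inE kL orbT.
rewrite /null ab ?mem_head //; congr (_ + _ + _).
by apply: eq_in_count => k kL; rewrite /null ab // inE kL orbT.
Qed.

(** * The cost of a reordering pass *)

Section RefillForward.

Variables (n : nat) (arc : rel 'I_n) (r : rel nat) (reach : pred 'I_n).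
Variables (X Q0 : seq 'I_n) (L0 : seq nat) (N0 : numbering n).
Hypothesis r_asym : forall k l, r k l -> ~~ r l k.
Hypothesis reach_closed : forall x y, reach x -> arc x y -> reach y.

Local Notation refilling := (refilling r reach X Q0 L0 N0).
Local Notation ordered := (ordered arc r X).

Definition refilled (L : seq nat) (Q : seq 'I_n) (N N' : numbering n) : Prop :=
  exists L',
    refilling L' [::] N' /\
    (irreflexive arc -> ordered L Q (position N) ->
     ordered L' [::] (position N')).

Lemma refilled_step i L Q N Q' N' N'' :
  refilling (i :: L) Q N -> placed arc Q i N Q' N' ->
  refilled L Q' N' N'' -> refilled (i :: L) Q N N''.
Proof.
move=> refN plc [L' [refN' ordN']]; exists L'; split=> // irr ordN.
by apply: ordN' => //; exact (ordered_step r_asym irr refN plc ordN).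
Qed.

Lemma placed_weight i L Q N Q' N' :
  refilling (i :: L) Q N -> placed arc Q i N Q' N' ->
  null_weight (vertex N) (i :: L) = size Q + null_weight (vertex N') L.
Proof.
move=> refN plc; rewrite /= (refilling_size refN); congr (_ + _).
have /= /andP[iL _] := slots_uniq (refilling_slots refN).
apply: null_weight_eq => k kL; case: plc => //= h Q1 a _ ->.
by case: eqP => // ki; rewrite -ki kL in iL.
Qed.

(** A round costs at most [size Q + 11], hence at most [12 * size Q] as the queue is nonempty, and
    the queue lengths add up to [null_weight]. *)
Lemma refill_forwardP fuel Q i N :
  refilling (index_iota i n.+1) Q N -> n.+1 - i < fuel ->
  outcome (reorder_forward arc fuel Q i N) (fun t s =>
    refilled (index_iota i n.+1) Q N s.2 /\
    t <= 1 + 12 * null_weight (vertex N) (index_iota i n.+1)).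
Proof.
rewrite /reorder_forward; elim: fuel Q i N => // fuel IH Q i N refN i_fuel.
rewrite loopS; apply: outcome_bind; apply: outcome_op_bind.
have [Q0'|Q_neq0] := eqVneq Q [::].
  rewrite Q0' in refN *; do 2!apply: outcome_ret.
  by split=> //; exists (index_iota i n.+1).
rewrite /nilp size_eq0 (negbTE Q_neq0).
(* A nonempty queue has a null slot ahead of it, so the pass does not leave the array. *)
have i_n : i < n.+1.
  rewrite ltnNge; apply: contra Q_neq0 => n_i.
  have /= := refilling_size refN.
  by rewrite /index_iota (eqP n_i) /= => /size0nil ->.
have LE : index_iota i n.+1 = i :: index_iota i.+1 n.+1.
  by rewrite /index_iota subSn //= subSS.
rewrite LE in refN *.
apply: (@placeP _ arc _ (arc_from_queue arc) Q i N
  (fun x => let: (F, N) := x in i <~ op i.+1 ;; ret (true, (F, i, N)))) => //.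
  exact: arc_from_queueE.
move=> Q' N' plc; apply: outcome_op_bind; refine (outcome_ret _) => k k_le.
apply: outcome_imp (IH Q' i.+1 N' _ _) _.
- exact (refilling_step reach_closed refN plc).
- by lia.
move=> t s [refs t_le]; split; first exact (refilled_step refN plc refs).
rewrite (placed_weight refN plc); move: (null_weight _ _) t_le => W t_le.
by move: Q_neq0 k_le; rewrite -size_eq0; move: (size Q) => q; lia.
Qed.

End RefillForward.

Section RefillBackward.

Variables (n : nat) (arc : rel 'I_n) (r : rel nat) (reach : pred 'I_n).
Variables (X Q0 : seq 'I_n) (L0 : seq nat) (N0 : numbering n).
Hypothesis r_asym : forall k l, r k l -> ~~ r l k.
Hypothesis reach_closed : forall x y, reach x -> arc y x -> reach y.

Lemma refill_backwardP fuel Q j N :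
  refilling r reach X Q0 L0 N0 (rev (index_iota 1 j)) Q N -> j < fuel ->
  outcome (reorder_backward arc fuel Q j N) (fun t s =>
    refilled (converse arc) r reach X Q0 L0 N0 (rev (index_iota 1 j)) Q N s.2 /\
    t <= 1 + 12 * null_weight (vertex N) (rev (index_iota 1 j))).
Proof.
rewrite /reorder_backward; elim: fuel Q j N => // fuel IH Q j N refN j_fuel.
rewrite loopS; apply: outcome_bind; apply: outcome_op_bind.
have [Q0'|Q_neq0] := eqVneq Q [::].
  rewrite Q0' in refN *; do 2!apply: outcome_ret.
  by split=> //; exists (rev (index_iota 1 j)).
rewrite /nilp size_eq0 (negbTE Q_neq0).
have j_gt1 : 1 < j.
  rewrite ltnNge; apply: contra Q_neq0 => n_i.
  have /= := refilling_size refN.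
  by rewrite /index_iota (eqP n_i) /= => /size0nil ->.
have LE : rev (index_iota 1 j) = j.-1 :: rev (index_iota 1 j.-1).
  case: j j_gt1 {refN j_fuel} => [|[|j]] // _.
  have := iotaD 1 j 1; rewrite addn1 add1n /index_iota !subn1 => ->.
  by rewrite rev_cat.
rewrite LE in refN *; apply: outcome_op_bind.
apply: (@placeP _ (converse arc) _ (fun Q o => arc_to_queue arc o Q) Q j.-1 N
  (fun x => let: (B, N) := x in ret (true, (B, j.-1, N)))) => //.
  by move=> ? ?; exact: arc_to_queueE.
move=> Q' N' plc; refine (outcome_ret _) => k k_le.
apply: outcome_imp (IH Q' j.-1 N' _ _) _.
- exact (refilling_step reach_closed refN plc).
- by lia.
move=> t s [refs t_le]; split; first exact (refilled_step r_asym refN plc refs).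
rewrite (placed_weight refN plc); move: (null_weight _ _) t_le => W t_le.
by move: Q_neq0 k_le; rewrite -size_eq0; move: (size Q) => q; lia.
Qed.

End RefillBackward.

(** Double counting: a null slot is counted once for each slot of [L] up to and including itself. *)
Lemma null_weightE (V : Type) (a : array V) L :
  uniq L ->
  null_weight a L = \sum_(k <- L | null a k) (index k L).+1.
Proof.
elim: L => [|i L IH] /=; first by rewrite big_nil.
case/andP=> iL /IH ->; rewrite big_cons /= eqxx -sum1_count.
have -> : \sum_(k <- L | null a k) (if i == k then 0 else (index k L).+1).+1 =
          \sum_(k <- L | null a k) 1 + \sum_(k <- L | null a k) (index k L).+1.
  rewrite -big_split /= big_seq_cond [RHS]big_seq_cond.
  by apply: eq_bigr => k /andP[kL _]; case: eqP => // ik; rewrite ik kL in iL.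
by case: (null a i) => /=; rewrite ?add0n // addnA.
Qed.

(** * The bidirectional search *)

Lemma valid_position_inj n (N : numbering n) :
  valid_numbering N -> injective (position N).
Proof.
case=> _ inv x y xy; have /inv Nx : position N x = position N x by [].
by have /inv := esym xy; rewrite Nx => -[].
Qed.

Lemma valid_positions n (N : numbering n) :
  valid_numbering N -> perm_eq (map (position N) (enum 'I_n)) (iota 1 n).
Proof.
move=> vN; have us : uniq (map (position N) (enum 'I_n)).
  by rewrite map_inj_uniq ?enum_uniq //; exact: valid_position_inj.
apply: uniq_perm; rewrite ?iota_uniq //.
have sub : {subset map (position N) (enum 'I_n) <= iota 1 n}.
  by move=> _ /mapP[x _ ->]; rewrite mem_iota; have := vN.1 x; lia.
have [|_ //] := uniq_min_size us sub.
by rewrite size_iota size_map size_enum_ord.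
Qed.

Lemma valid_vertex n (N : numbering n) k :
  valid_numbering N -> 1 <= k <= n -> exists x, vertex N k = Some x.
Proof.
move=> vN k_n; have : k \in map (position N) (enum 'I_n).
  by rewrite (perm_mem (valid_positions vN)) mem_iota; lia.
by case/mapP=> x _ ->; exists x; apply/(vN.2).
Qed.

Section Search.

Variables (n : nat) (e : rel 'I_n) (N : numbering n) (v w : 'I_n).
Hypothesis valid_N : valid_numbering N.
Hypothesis pos_arc : forall x y, e x y -> (x, y) != (v, w) ->
  position N x < position N y.

Local Notation pos := (position N).

(** The bound [i <= j] is not strict, so that the record also describes the state in which the
    search stops. [frontier_closed] and [frontier_coclosed] express that the scans have missed no
    neighbour. *)
Record frontier (F B : seq 'I_n) (i j : nat) (a : array 'I_n) : Prop :=
    Frontier {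
  frontier_bounds : [/\ 0 < i, i <= j & j <= n];
  frontier_inverse : forall k x,
    a k = Some x <-> [/\ pos x = k, x \notin F & x \notin B];
  frontier_forward : forall x, x \in F -> pos x <= i /\ connect e w x;
  frontier_backward : forall x, x \in B -> j <= pos x /\ connect e x v;
  frontier_apart : forall x y, x \in F -> y \in B -> pos x < pos y;
  frontier_increasing : pairwise (fun x y => pos x < pos y) F;
  frontier_decreasing : pairwise (fun x y => pos y < pos x) B;
  frontier_closed : forall x y, e x y -> x \in F -> y \notin F -> y \notin B ->
    i <= pos y;
  frontier_coclosed : forall x y, e x y -> y \in B -> x \notin F ->
    x \notin B -> pos x <= j;
  frontier_low : a i = None;
  frontier_high : a j = None;
  frontier_ends : w \in F /\ v \in B
}.

(** With [i = j = c] this is the sum [D] of the distances to [c]. *)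
Definition spread (F B : seq 'I_n) (i j : nat) : nat :=
  \sum_(x <- F) (i - pos x) + \sum_(x <- B) (pos x - j).

(** Slot [i] is null and the slots strictly between [i] and [i'] were tested without a hit. Each
    slot passed moves the index one further from every member of [F], so that the growth of the
    spread can pay for the tests. *)
Lemma frontier_advance F B i j i' a :
  frontier F B i j a -> i < j -> i < i' <= j ->
  (forall k, i < k < i' -> ~~ hits e F (a k)) ->
  (forall x y, e x y -> x \in F -> y \notin F -> y \notin B -> i' <= pos y) /\
  (spread F B i' j = spread F B i j + size F * (i' - i)).
Proof.
move=> fr ij ii' nohit; split.
  move=> x y xy xF yF yB; have := frontier_closed fr xy xF yF yB.
  rewrite leq_eqVlt => /orP[/eqP iy|iy].
    have : a i = Some y by apply/(frontier_inverse fr); split.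
    by rewrite (frontier_low fr).
  rewrite leqNgt; apply/negP => yi'.
  have ay : a (pos y) = Some y by apply/(frontier_inverse fr); split.
  have := nohit (pos y); rewrite iy yi' ay /= => /(_ isT) /hasP; apply.
  by exists x.
have sumE : \sum_(x <- F) (i' - pos x) = \sum_(x <- F) (i - pos x) + size F * (i' - i).
  rewrite -sum1_size big_distrl /= -big_split /= big_seq [RHS]big_seq.
  by apply: eq_bigr => x /(frontier_forward fr)[]; lia.
by rewrite /spread sumE; lia.
Qed.

Lemma frontier_retreat F B i j j' a :
  frontier F B i j a -> i < j -> i <= j' < j ->
  (forall k, j' < k < j -> ~~ hits (converse e) B (a k)) ->
  (forall x y, e x y -> y \in B -> x \notin F -> x \notin B -> pos x <= j') /\
  (spread F B i j' = spread F B i j + size B * (j - j')).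
Proof.
move=> fr ij j'j nohit; split.
  move=> x y xy yB xF xB; have := frontier_coclosed fr xy yB xF xB.
  rewrite leq_eqVlt => /orP[/eqP jx|jx].
    have : a j = Some x by apply/(frontier_inverse fr); split.
    by rewrite (frontier_high fr).
  rewrite leqNgt; apply/negP => xj'.
  have ax : a (pos x) = Some x by apply/(frontier_inverse fr); split.
  have := nohit (pos x); rewrite jx xj' ax /= => /(_ isT) /hasP; apply.
  by exists y.
have sumE : \sum_(x <- B) (pos x - j') = \sum_(x <- B) (pos x - j) + size B * (j - j').
  rewrite -sum1_size big_distrl /= -big_split /= big_seq [RHS]big_seq.
  by apply: eq_bigr => x /(frontier_backward fr)[]; lia.
by rewrite /spread sumE addnA.
Qed.

Lemma frontier_inject_low F B i j i' a x :
  frontier F B i j a -> i < i' < j -> a i' = Some x -> hits e F (Some x) ->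
  (forall x y, e x y -> x \in F -> y \notin F -> y \notin B -> i' <= pos y) ->
  frontier (rcons F x) B i' j (set_entry a i' None).
Proof.
case=> [[i0 ij jn] inv frF frB apart inc dec cl cocl lo hi [wF vB]] i'j ax
  /hasP[u uF ux] cl'.
have [/(_ ax) [px xF xB] _] := inv i' x.
have memF y : y \in rcons F x -> y = x \/ y \in F.
  by rewrite mem_rcons inE => /orP[/eqP|]; [left|right].
have notF y : y \notin rcons F x -> y != x /\ y \notin F.
  by rewrite mem_rcons inE negb_or => /andP.
split=> //.
- by split=> //; lia.
- move=> k y; rewrite /set_entry; case: eqP => [->|/eqP k_i'].
    split=> // -[py /notF[y_x yF] yB].
    have : a i' = Some y by apply/inv; split.
    by rewrite ax => -[xy]; rewrite xy eqxx in y_x.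
  rewrite inv; split=> -[py yF yB]; split=> //; last by case: (notF y yF).
  rewrite mem_rcons inE negb_or yF andbT; apply: contra_neq k_i' => yx.
  by rewrite -py yx.
- move=> y /memF[->|/frF[? ?]]; last by split=> //; lia.
  rewrite px; split=> //; have [_ wu] := frF u uF.
  exact: connect_trans wu (connect1 ux).
- by move=> y z /memF[->|yF zB]; [move=> /frB[]; lia | apply: apart].
- rewrite pairwise_rcons inc andbT; apply/allP => y /frF[]; lia.
- move=> y z yz /memF[yx|yF] /notF[z_x zF] zB; last exact: cl' yz yF zF zB.
  (* The exceptional arc [(v, w)] is ruled out because [w] is already in [F]. *)
  rewrite yx in yz; rewrite -px; apply/ltnW/pos_arc => //.
  by apply: contraNneq zF => -[_ ->].
- by move=> y z yz zB /notF[_ yF] yB; apply: cocl yz zB yF yB.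
- by rewrite /set_entry eqxx.
- by rewrite /set_entry; case: eqP.
- by split=> //; rewrite mem_rcons inE wF orbT.
Qed.

Lemma frontier_inject_high F B i j j' a x :
  frontier F B i j a -> i < j' < j -> a j' = Some x ->
  hits (converse e) B (Some x) ->
  (forall x y, e x y -> y \in B -> x \notin F -> x \notin B -> pos x <= j') ->
  frontier F (rcons B x) i j' (set_entry a j' None).
Proof.
case=> [[i0 ij jn] inv frF frB apart inc dec cl cocl lo hi [wF vB]] ij' ax
  /hasP[u uB xu] cocl'.
have [/(_ ax) [px xF xB] _] := inv j' x.
have memB y : y \in rcons B x -> y = x \/ y \in B.
  by rewrite mem_rcons inE => /orP[/eqP|]; [left|right].
have notB y : y \notin rcons B x -> y != x /\ y \notin B.
  by rewrite mem_rcons inE negb_or => /andP.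
split=> //.
- by split=> //; lia.
- move=> k y; rewrite /set_entry; case: eqP => [->|/eqP k_j'].
    split=> // -[py yF /notB[y_x yB]].
    have : a j' = Some y by apply/inv; split.
    by rewrite ax => -[xy]; rewrite xy eqxx in y_x.
  rewrite inv; split=> -[py yF yB]; split=> //; last by case: (notB y yB).
  rewrite mem_rcons inE negb_or yB andbT; apply: contra_neq k_j' => yx.
  by rewrite -py yx.
- move=> y /memB[->|/frB[? ?]]; last by split=> //; lia.
  rewrite px; split=> //; have [_ uv] := frB u uB.
  exact: connect_trans (connect1 (xu : e x u)) uv.
- by move=> y z yF /memB[->|zB]; [have [] := frF y yF; lia | apply: apart].
- rewrite pairwise_rcons dec andbT; apply/allP => y /frB[]; lia.
- by move=> y z yz yF zF /notB[_ zB]; apply: cl yz yF zF zB.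
- move=> y z yz /memB[zx|zB] yF /notB[y_x yB]; last exact: cocl' yz zB yF yB.
  rewrite zx in yz; rewrite -px; apply/ltnW/pos_arc => //.
  by apply: contraNneq yB => -[->].
- by rewrite /set_entry; case: eqP.
- by rewrite /set_entry eqxx.
- by split=> //; rewrite mem_rcons inE vB orbT.
Qed.

(** The count says that the null slots from the meeting slot upwards are exactly as many as [F]
    needs. *)
Definition searched (s : search_state n) : Prop :=
  let: SearchState F B i j a := s in
  [/\ frontier F B i j a, i = j & count (fun x => i <= pos x) (F ++ B) = size F].

Definition spread_of (s : search_state n) : nat :=
  let: SearchState F B i j _ := s in spread F B i j.

(** A half round that raises the spread by [D] costs at most [5 * D + 5], and [D >= 1] since it
    passes a slot with a nonempty queue. Injecting adds nothing to the spread, as the new member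
    sits at the current index. *)
Lemma search_loopP fuel k F B i j a :
  n < fuel -> frontier F B i j a -> i < j -> size F = size B -> j - i < k ->
  outcome (loop k (search_round e fuel) (SearchState F B i j a)) (fun t s =>
    searched s /\ t + 10 * spread F B i j <= 10 * spread_of s).
Proof.
move=> n_fuel; elim: k F B i j a => // k IH F B i j a fr ij szFB ij_k.
have [[i0 _ jn] inv frF frB apart _ _ _ _ _ _ [wF vB]] := fr.
have F_gt0 : 0 < size F by case: (F) wF.
rewrite loopS; apply: outcome_bind; rewrite /search_round.
apply: outcome_op_bind; apply: outcome_seq (advanceP e F a _ _) _; [lia..|].
move=> t1 i' [/andP[ii' i'j] nohit1 hit1 t1_le].
have ii'j : i < i' <= j by lia.
have [cl1 spread1] := frontier_advance fr ij ii'j nohit1.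
have {}t1_le : t1 <= 5 * (size F * (i' - i)).
  have : (i' - i) * (size F + 4) <= (i' - i) * (5 * size F).
    by rewrite leq_mul2l; move: (size F) F_gt0 => f; lia.
  by move: t1_le; rewrite subSS; lia.
have prod1 : 0 < size F * (i' - i) by rewrite muln_gt0 F_gt0; lia.
move: (size F * (i' - i)) prod1 t1_le spread1 => D1 prod1 t1_le spread1.
apply: outcome_op_bind; move: hit1; case: eqP => [i'_j _|i'_j /=].
  do 2!apply: outcome_ret; split; last by rewrite /= spread1; lia.
  split=> //=.
    case: fr => *; split=> //; try by rewrite i'_j.
      - by split=> //; lia.
      - by move=> x /frF[]; split=> //; lia.
  (* The forward scan ended the search: all of [B] and none of [F] lie at or above the meeting slot,
     and the queues have equal size. *)
  rewrite count_cat; have -> : count (fun x => i' <= pos x) F = 0.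
    apply/eqP; rewrite -leqn0 leqNgt -has_count; apply/hasP => -[x /frF[]]; lia.
  rewrite szFB add0n; apply/eqP; rewrite -all_count; apply/allP => x /frB[]; lia.
case ax: (a i') => [x|] //= hit1.
rewrite /inject_entry; apply: outcome_bind; apply: outcome_op_bind; rewrite ax.
do 2!apply: outcome_op_bind; apply: outcome_ret.
have ii'lt : i < i' < j by lia.
have fr1 := frontier_inject_low fr ii'lt ax hit1 cl1.
have [/(_ ax) [px xF xB] _] := inv i' x.
have spread1' : spread (rcons F x) B i' j = spread F B i' j.
  by rewrite /spread -cats1 big_cat big_seq1 /= px subnn addn0.
apply: outcome_op_bind; apply: outcome_seq (retreatP e B _ _ _) _; [lia..|].
move=> t2 j' [/andP[i'j' j'j] nohit2 hit2 t2_le].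
have ij'j : i' <= j' < j by lia.
have i'j_lt : i' < j by lia.
have nohit2' k' : j' < k' < j ->
    ~~ hits (converse e) B (set_entry a i' None k').
  by move=> k'_j; apply: nohit2; lia.
have [cl2 spread2] := frontier_retreat fr1 i'j_lt ij'j nohit2'.
have B_gt0 : 0 < size B by rewrite -szFB.
have {}t2_le : t2 <= 5 * (size B * (j - j')).
  have : (j - j') * (size B + 4) <= (j - j') * (5 * size B).
    by rewrite leq_mul2l; move: (size B) B_gt0 => f; lia.
  by move: t2_le; rewrite prednK; lia.
have prod2 : 0 < size B * (j - j') by rewrite muln_gt0 B_gt0; lia.
move: (size B * (j - j')) prod2 t2_le spread2 => D2 prod2 t2_le spread2.
apply: outcome_op_bind; move: hit2; case: eqP => [i'_j' _|i'_j' /=].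
  do 2!apply: outcome_ret; split; last by rewrite /= spread2 spread1' spread1; lia.
  split=> //=.
    case: fr1 => *; split=> //; try by rewrite -i'_j'.
      - by split=> //; lia.
      - by move=> y /frB[]; split=> //; lia.
  (* The backward scan ended the search: [F] has one member more than [B], namely [x], which sits at
     the meeting slot itself. *)
  rewrite count_cat -cats1 count_cat /= px leqnn.
  have -> : count (fun x => i' <= pos x) F = 0.
    apply/eqP; rewrite -leqn0 leqNgt -has_count; apply/hasP => -[y /frF[]]; lia.
  rewrite size_cat szFB /= addn1 add0n addn0 add1n; congr _.+1.
  by apply/eqP; rewrite -all_count; apply/allP => y /frB[]; lia.
case ay: (set_entry a i' None j') => [y|] //= hit2.
rewrite /inject_entry; apply: outcome_bind; apply: outcome_op_bind.
do 2!apply: outcome_op_bind; do 2!apply: outcome_ret.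
have i'j'_lt : i' < j' < j by lia.
have fr2 := frontier_inject_high fr1 i'j'_lt ay hit2 cl2.
have [/(_ ay) [py _ _] _] := frontier_inverse fr1 j' y.
have spread2' : spread (rcons F x) (rcons B y) i' j' = spread (rcons F x) B i' j'.
  by rewrite /spread -[rcons B y]cats1 big_cat big_seq1 /= py subnn !addn0.
apply: outcome_imp (IH _ _ _ _ _ fr2 _ _ _) _; [lia|by rewrite !size_rcons szFB|lia|].
move=> t s [ss t_le]; split=> //; lia.
Qed.

Lemma searchP fuel :
  n < fuel -> pos w < pos v ->
  outcome (search e fuel N v w) (fun t s =>
    searched s /\ t <= 6 + 10 * spread_of s).
Proof.
move=> n_fuel wv; rewrite /search; do 6!apply: outcome_op_bind.
have [rng inv] := valid_N.
have w_rng := rng w; have v_rng := rng v.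
have pinj := valid_position_inj valid_N.
have fr : frontier [:: w] [:: v] (pos w) (pos v)
    (set_entry (set_entry (vertex N) (pos w) None) (pos v) None).
  split=> //.
  - by split; lia.
  - move=> k x; rewrite /set_entry !inE -(inj_eq pinj) -[x == v](inj_eq pinj).
    case: (eqVneq k (pos v)) => [->|kv].
      by split=> // -[->]; rewrite eqxx.
    case: (eqVneq k (pos w)) => [->|kw].
      by split=> // -[->]; rewrite eqxx.
    by rewrite inv; split=> [xk|[]//]; split=> //; rewrite xk.
  - by move=> x; rewrite inE => /eqP ->.
  - by move=> x; rewrite inE => /eqP ->.
  - by move=> x y; rewrite !inE => /eqP -> /eqP ->.
  - move=> x y xy; rewrite !inE => /eqP xw _ _; rewrite -xw ltnW // pos_arc //.
    by apply: contraTneq wv => -[<- _]; rewrite xw ltnn.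
  - move=> x y xy; rewrite !inE => /eqP yv _ _; rewrite -yv ltnW // pos_arc //.
    by apply: contraTneq wv => -[_ <-]; rewrite yv ltnn.
  - by rewrite /set_entry eqxx; case: ifP.
  - by rewrite /set_entry eqxx.
  - by rewrite !mem_head.
apply: outcome_imp (search_loopP n_fuel fr wv _ _) _ => //; first by lia.
by move=> t s [ss t_le]; split=> //; lia.
Qed.

End Search.

(** * The new numbering *)

Lemma acyclic_path (T : finType) (e : rel T) x y :
  acyclic e -> e x y -> ~~ connect e y x.
Proof.
move=> ac xy; apply/connectP => -[p yp xE].
by have := ac (y :: p); rewrite /= rcons_path yp -xE xy => /(_ isT).
Qed.

Lemma index_index_iota c m k :
  k \in index_iota c m -> index k (index_iota c m) = k - c.
Proof.
move=> kL; have := kL; rewrite mem_index_iota => /andP[ck km].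
have nthE : nth 0 (index_iota c m) (k - c) = k by rewrite nth_iota; lia.
by rewrite -{1}nthE index_uniq ?iota_uniq // size_iota; lia.
Qed.

Lemma index_rev_index_iota j k :
  k \in index_iota 1 j -> (index k (rev (index_iota 1 j))).+1 = j - k.
Proof.
move=> kL; have := kL; rewrite mem_index_iota => /andP[k0 kj].
have nthE : nth 0 (rev (index_iota 1 j)) (j - k).-1 = k.
  by rewrite nth_rev ?size_iota ?nth_iota; lia.
by rewrite -{1}nthE index_uniq ?rev_uniq ?iota_uniq // ?size_rev ?size_iota; lia.
Qed.

Section Reorder.

Variables (n : nat) (e : rel 'I_n) (N : numbering n) (v w : 'I_n).
Hypothesis valid_N : valid_numbering N.
Hypothesis pos_arc : forall x y, e x y -> (x, y) != (v, w) ->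
  position N x < position N y.
Hypothesis e_vw : e v w.

Variables (F B : seq 'I_n) (c : nat) (a : array 'I_n).
Hypothesis fr : frontier e N v w F B c c a.
Hypothesis F_slots : count (fun x => c <= position N x) (F ++ B) = size F.

Local Notation pos := (position N).

Lemma pos_inj : injective pos.
Proof. exact: valid_position_inj. Qed.

Lemma pos_range x : 1 <= pos x <= n.
Proof. by case: valid_N. Qed.

Lemma c_range : 1 <= c <= n.
Proof. by have [c0 _ cn] := frontier_bounds fr; rewrite c0. Qed.

Lemma F_notin_B x : x \in F -> x \notin B.
Proof. by move=> xF; apply/negP => /(frontier_apart fr xF); rewrite ltnn. Qed.

Lemma FB_uniq : uniq (F ++ B).
Proof.
rewrite cat_uniq; apply/and3P; split.
- by apply: (pairwise_uniq _ (frontier_increasing fr)) => x; rewrite ltnn.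
- by apply/hasPn => x xB; apply: contraL xB; apply: F_notin_B.
- by apply: (pairwise_uniq _ (frontier_decreasing fr)) => x; rewrite ltnn.
Qed.

Lemma null_slots L :
  uniq L -> (forall k, k \in L -> 1 <= k <= n) ->
  perm_eq [seq k <- L | null a k] [seq pos x | x <- F ++ B & pos x \in L].
Proof.
move=> uL L_n; apply: uniq_perm.
- exact: filter_uniq.
- by rewrite map_inj_uniq ?filter_uniq ?FB_uniq //; exact: pos_inj.
move=> k; rewrite mem_filter; apply/andP/mapP.
  case=> ak kL; have [x xk] := valid_vertex valid_N (L_n k kL).
  have px : pos x = k by apply/(valid_N.2).
  exists x => //; rewrite mem_filter px kL mem_cat.
  apply: contraT; rewrite negb_or => /andP[xF xB].
  have ak' : a k = Some x by apply/(frontier_inverse fr).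
  by rewrite /null ak' in ak.
case=> x; rewrite mem_filter => /andP[xL xFB] ->; split=> //.
rewrite /null; case ax: (a (pos x)) => [y|] //.
have [/(_ ax) [yx yF yB] _] := frontier_inverse fr (pos x) y.
by move/pos_inj: yx yF yB xFB => -> xF xB; rewrite mem_cat (negbTE xF) (negbTE xB).
Qed.

Lemma count_null L :
  uniq L -> (forall k, k \in L -> 1 <= k <= n) ->
  count (null a) L = count (fun x => pos x \in L) (F ++ B).
Proof.
move=> uL L_n; rewrite -!size_filter (perm_size (null_slots uL L_n)).
by rewrite size_map.
Qed.

Lemma null_weight_slots L :
  uniq L -> (forall k, k \in L -> 1 <= k <= n) ->
  null_weight a L =
  \sum_(x <- F ++ B | pos x \in L) (index (pos x) L).+1.
Proof.
move=> uL L_n; rewrite null_weightE // -big_filter (perm_big _ (null_slots uL L_n)).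
by rewrite big_map big_filter.
Qed.

(** The slots of the forward pass; they include the meeting slot [c], at which the backward pass
    does not act. *)
Definition upper := index_iota c n.+1.
Definition lower := rev (index_iota 1 c).

Lemma mem_upper k : (k \in upper) = (c <= k <= n).
Proof. by rewrite mem_index_iota ltnS. Qed.

Lemma mem_lower k : (k \in lower) = (0 < k < c).
Proof. by rewrite mem_rev mem_index_iota. Qed.

Lemma slots_upper : slots n ltn upper upper.
Proof.
have c_n := c_range.
split=> //.
- by move=> k; rewrite mem_upper; lia.
- exact: iota_uniq.
- by rewrite -sorted_pairwise; [exact: iota_ltn_sorted | exact: ltn_trans].
- by move=> k l; rewrite !mem_upper /=; lia.
Qed.

Lemma slots_lower : slots n gtn lower lower.
Proof.
have c_n := c_range.
split=> //.
- by move=> k; rewrite mem_lower; lia.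
- by rewrite rev_uniq iota_uniq.
- rewrite -sorted_pairwise; last by move=> x y z /= xy zx; apply: ltn_trans xy.
  by rewrite rev_sorted; exact: iota_ltn_sorted.
- by move=> k l; rewrite !mem_lower /=; lia.
Qed.

(** A null slot at distance [d] above [c] has weight [d + 1], and a member of [F] can lie in [upper]
    only at [c] itself, with weight [1]. *)
Lemma upper_weight :
  null_weight a upper <= \sum_(x <- B) (pos x - c) + size F + size B.
Proof.
have sl := slots_upper.
rewrite null_weight_slots; [|exact: slots_uniq sl|exact: slots_range sl].
rewrite big_cat /= addnAC [X in _ <= X]addnC -!sum1_size -big_split /=.
rewrite leq_add //.
  rewrite big_mkcond big_seq [X in _ <= X]big_seq; apply: leq_sum => x xF.
  case: ifP => // xL; rewrite index_index_iota //.
  by have [] := frontier_forward fr xF; lia.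
rewrite big_mkcond; apply: leq_sum => x _; case: ifP => // xL.
by rewrite index_index_iota // addn1.
Qed.

(** The pass starts at [c.-1], so that the weight of a slot is exactly its distance to [c]; no
    member of [B] lies below [c]. *)
Lemma lower_weight : null_weight a lower <= \sum_(x <- F) (c - pos x).
Proof.
have sl := slots_lower.
rewrite null_weight_slots; [|exact: slots_uniq sl|exact: slots_range sl].
rewrite big_cat /= [X in _ + X]big1_seq ?addn0; last first.
  move=> x /andP[]; rewrite mem_lower => xc /(frontier_backward fr)[]; lia.
rewrite big_mkcond; apply: leq_sum => x _; case: ifP => //.
by rewrite mem_rev => xL; rewrite index_rev_index_iota.
Qed.

Lemma upper_refilling :
  refilling ltn (connect e w) B F upper (Numbering pos a) upper F (Numbering pos a).
Proof.
have c_n := c_range; split=> //=.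
- exact: slots_upper.
- by have := FB_uniq; rewrite cat_uniq => /andP[].
- exact: frontier_inverse fr.
- have sl := slots_upper.
  rewrite count_null; [|exact: slots_uniq sl|exact: slots_range sl].
  rewrite -F_slots; apply: eq_count => x; rewrite mem_upper.
  by have /andP[_ ->] := pos_range x; rewrite andbT.
- exact: pos_range.
- move=> x xF; have [xc wx] := frontier_forward fr xF.
  split; rewrite ?xF ?F_notin_B //.
  rewrite /upper /index_iota subSn; last by case/andP: c_n.
  by rewrite /= mem_iota; lia.
- by move=> x; left.
- by move=> x; left.
Qed.

(** The arc [(v, w)] starts in the excluded set [B], so the arcs to be considered agree with the old
    numbering. *)
Lemma upper_ordered : ordered e ltn B upper F pos.
Proof.
have c_n := c_range; have [wF vB] := frontier_ends fr.
have notB_arc x y : e x y -> x \notin B -> pos x < pos y.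
  by move=> xy xB; apply: pos_arc => //; apply: contraNneq xB => -[-> _].
split.
- by move=> x y xy xB _ _ _; apply: notB_arc.
- move=> x y xy xB xF yF; have := notB_arc x y xy xB.
  by have [] := frontier_forward fr yF; rewrite mem_upper; lia.
- move=> x y xy yB xF yF; have := frontier_closed fr xy xF yF yB.
  by have := pos_range y; rewrite mem_upper; lia.
- apply: (sub_in_pairwise (P := mem F) _ _ (frontier_increasing fr)); last exact/allP.
  move=> x y xF yF /= xy; apply/negP => yx.
  by have := notB_arc y x yx (F_notin_B yF); lia.
Qed.

Lemma arc_irreflexive : acyclic e -> irreflexive e.
Proof.
by move=> ac x; apply/negP => xx; have := ac [:: x]; rewrite /= xx => /(_ isT).
Qed.

Variable fuel : nat.
Hypothesis n_fuel : n.+1 < fuel.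

Definition raised (N1 : numbering n) : Prop :=
  exists L, refilling ltn (connect e w) B F upper (Numbering pos a) L [::] N1 /\
            (acyclic e -> ordered e ltn B L [::] (position N1)).

Lemma raiseP :
  outcome (reorder_forward e fuel F c (Numbering pos a)) (fun t s =>
    raised s.2 /\ t <= 1 + 12 * null_weight a upper).
Proof.
have c_n := c_range.
apply: outcome_imp (refill_forwardP (r := ltn) _ _ upper_refilling _) _.
- by move=> k l /=; lia.
- by move=> x y wx xy; apply: connect_trans (connect1 xy).
- by lia.
move=> t s [[L [refs ords]] t_le]; split=> //; exists L; split=> // ac.
apply: ords; [exact: arc_irreflexive | exact: upper_ordered].
Qed.

Variable N1 : numbering n.
Hypothesis raised_N1 : raised N1.

Local Notation pos1 := (position N1).

Lemma raised_pos x : pos1 x = pos x \/ [/\ pos x < pos1 x, c <= pos1 x & connect e w x].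
Proof.
have [L [refN _]] := raised_N1.
case: (refilling_moved refN x) => [->|[? + _ ? _]]; first by left.
by rewrite mem_upper => /andP[? _]; right.
Qed.

Lemma raised_F x : x \in F -> c <= pos1 x.
Proof.
have [L [refN _]] := raised_N1.
by case/(refilling_source refN) => //; rewrite mem_upper => /andP[].
Qed.

Lemma raised_B x : x \in B -> pos1 x = pos x.
Proof.
have [L [refN _]] := raised_N1.
exact: (refilling_excluded refN).
Qed.

Lemma raised_lower k : k \in lower -> vertex N1 k = a k.
Proof.
have [L [refN _]] := raised_N1.
rewrite mem_lower => k_c; apply: (refilling_frame refN).
by rewrite mem_upper; lia.
Qed.

Lemma lower_refilling :
  refilling gtn (fun x => connect e x v) [::] B lower N1 lower B N1.
Proof.
have c_n := c_range; have sl := slots_lower.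
have [L [refN _]] := raised_N1; split=> //=.
- by have := FB_uniq; rewrite cat_uniq => /and3P[].
- by move=> k x; rewrite (refilling_inverse refN); split=> -[].
- rewrite (_ : count _ _ = count (null a) lower); last first.
    by apply: eq_in_count => k kL; rewrite /null raised_lower.
  rewrite count_null; [|exact: slots_uniq sl|exact: slots_range sl].
  (* Of the [size F + size B] null slots, [size F] are at or above [c], which leaves [size B] below
     it. *)
  have := count_predC (fun x => c <= pos x) (F ++ B).
  rewrite F_slots size_cat => /addnI <-; apply: eq_count => x.
  by rewrite mem_lower /= -ltnNge; have /andP[-> _] := pos_range x.
- exact: refilling_range refN.
- move=> x xB; have [xc xv] := frontier_backward fr xB.
  split; rewrite ?xB //; apply/negP => /mem_behead.
  by rewrite mem_lower raised_B //; lia.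
- by move=> x; left.
- by move=> x; left.
Qed.

(** A vertex outside [B] with an arc into [B] is not reachable from [w], as this would close a cycle
    through [(v, w)]. So it was neither raised nor put into [F], and [frontier_coclosed] places it
    below the null slot [c]. *)
Lemma lower_ordered :
  acyclic e -> ordered (converse e) gtn [::] lower B pos1.
Proof.
move=> ac; have c_n := c_range; have [wF vB] := frontier_ends fr.
have [L [refN /(_ ac) ordN]] := raised_N1.
have wv := acyclic_path ac e_vw.
have notF_arc x y : e x y -> y \notin F -> pos x < pos y.
  by move=> xy yF; apply: pos_arc => //; apply: contraNneq yF => -[_ ->].
split.
- by move=> x y xy _ _ xB yB; apply: (ordered_settled ordN).
- move=> x y yx _ xB yB; suff : c <= pos1 x by rewrite mem_lower; lia.
  case: (raised_pos x) => [px|[]//].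
  have [xF|xF] := boolP (x \in F); first exact: raised_F.
  rewrite px; have := notF_arc y x yx xF.
  by have [] := frontier_backward fr yB; lia.
- move=> x y yx _ xB yB; have [_ xv] := frontier_backward fr xB.
  have no_wy : ~ connect e w y.
    move=> wy; case/negP: wv; apply: connect_trans wy _.
    exact: connect_trans (connect1 (yx : e y x)) xv.
  case: (raised_pos y) => [py|[] //]; rewrite mem_lower py.
  have yF : y \notin F by apply/negP => /(frontier_forward fr)[].
  have := frontier_coclosed fr yx xB yF yB; have := pos_range y.
  suff : pos y != c by lia.
  apply/eqP => yc; have : a c = Some y by apply/(frontier_inverse fr).
  by rewrite (frontier_low fr).
- apply: (sub_in_pairwise (P := mem B) _ _ (frontier_decreasing fr)); last exact/allP.
  move=> x y xB yB /= yx; apply/negP => xy.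
  have yF : y \notin F by apply: contraL yB; apply: F_notin_B.
  by have := notF_arc x y xy yF; lia.
Qed.

(** [renumbered_arc] is conditional because the last addition of a run may create a cycle. *)
Record renumbered (N2 : numbering n) : Prop := Renumbered {
  renumbered_valid : valid_numbering N2;
  renumbered_up : forall x, pos x < position N2 x -> connect e w x;
  renumbered_down : forall x, position N2 x < pos x -> connect e x v;
  renumbered_F : forall x, x \in F -> c <= position N2 x;
  renumbered_B : forall x, x \in B -> position N2 x <= c;
  renumbered_arc : acyclic e ->
    forall x y, e x y -> position N2 x < position N2 y
}.

Lemma lowerP :
  outcome (reorder_backward e fuel B c N1) (fun t s =>
    renumbered s.2 /\ t <= 1 + 12 * null_weight a lower).
Proof.
have c_n := c_range.
apply: outcome_imp (refill_backwardP (r := gtn) _ _ lower_refilling _) _.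
- by move=> k l /=; lia.
- by move=> x y xv yx; apply: connect_trans (connect1 yx) xv.
- by lia.
move=> t s [[L [refs ords]] t_le]; split; last first.
  by rewrite -(null_weight_eq raised_lower).
have moved x : position s.2 x = pos1 x \/
    [/\ position s.2 x < pos1 x, connect e x v & x \in B \/ pos1 x < c].
  case: (refilling_moved refs x) => [->|[? _ _ ? xB]]; first by left.
  right; split=> //; case/orP: xB; first by left.
  by rewrite mem_lower => /andP[_ ?]; right.
split.
- split; first exact: refilling_range refs.
  by move=> x i; rewrite (refilling_inverse refs); split=> [[]|].
- by move=> x; case: (moved x) => [|[? _ _]]; case: (raised_pos x) => [|[]] //; lia.
- by move=> x; case: (moved x) => [|[]] //; case: (raised_pos x) => [|[]]; lia.
- move=> x xF; have := raised_F xF.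
  case: (moved x) => [->//|[_ _ [xB|]]]; last by lia.
  by have := F_notin_B xF; rewrite xB.
- move=> x xB; case: (refilling_source refs xB) => //.
  by rewrite mem_lower; lia.
- move=> ac x y xy.
  have irr : irreflexive (converse e) by move=> z; exact: arc_irreflexive.
  exact: (ordered_settled (ords irr (lower_ordered ac)) (x := y) (y := x)).
Qed.

End Reorder.

Lemma cycle_testE n (e : rel 'I_n) F B :
  cycle_test e F B =
  Some ((size F * (size B).+1).+1, has (fun u => has (e u) B) F).
Proof.
rewrite /cycle_test; elim: F => //= u F IH.
by rewrite scan_op IH /bind /=; do 2?f_equal; lia.
Qed.

Definition is_topological {n : nat} (e : rel 'I_n) (p : 'I_n -> nat) : Prop :=
  forall x y, e x y -> p x < p y.

(** The [22] is [10 + 12]: per unit of spread the search pays [10] and the reordering [12]. *)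
Definition search_run {n : nat} (e : rel 'I_n) (N : numbering n) (v w : 'I_n)
    (t : nat) (r : option (numbering n)) : Prop :=
  exists F B c a,
    [/\ frontier e N v w F B c c a,
        t <= 22 * (1 + spread N F B c c + size F * size B) &
        if r is Some N' then renumbered e N v w F B c N' else True].

Lemma topological_searchP n (e : rel 'I_n) fuel (N : numbering n) v w :
  valid_numbering N -> e v w -> v != w ->
  (forall x y, e x y -> (x, y) != (v, w) -> position N x < position N y) ->
  n.+1 < fuel ->
  outcome (topological_search e fuel N v w) (fun t r =>
    [/\ position N v < position N w, r = Some N & t = 1] \/
    search_run e N v w t r).
Proof.
move=> valid_N e_vw v_w pos_arc n_fuel; rewrite /topological_search.
apply: outcome_op_bind; case: ltnP => [vw|wv].
  by apply: outcome_ret; left.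
have {}wv : position N w < position N v.
  rewrite ltn_neqAle wv andbT (inj_eq (valid_position_inj valid_N)).
  by rewrite eq_sym.
apply: outcome_seq (searchP valid_N pos_arc (ltnW n_fuel) wv) _.
move=> t1 [F B i c a] [[fr ic F_slots] t1_le].
move: ic fr F_slots t1_le => /= -> fr F_slots t1_le.
have [wF vB] := frontier_ends fr.
have F_gt0 : 0 < size F by case: (F) wF.
have B_gt0 : 0 < size B by case: (B) vB.
(* This absorbs the terms linear in the queue sizes into the product. *)
have FB_le : size F + size B <= size F * size B + 1.
  by case: (size F) F_gt0 (size B) B_gt0 => // f _ [|b] // _; lia.
have W1 := upper_weight valid_N e_vw fr F_slots.
have W2 := lower_weight valid_N e_vw fr F_slots.
have D_E : spread N F B c c = \sum_(x <- F) (c - position N x) +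
                              \sum_(x <- B) (position N x - c) by [].
move: (\sum_(x <- F) _) (\sum_(x <- B) _) D_E W1 W2 => D1 D2 D_E W1 W2.
rewrite cycle_testE mulnS; apply: outcome_bind; apply: outcome_val; case: ifP => _.
  apply: outcome_ret; right; exists F, B, c, a; split=> //; rewrite D_E in t1_le *.
  by move: (size F) (size B) B_gt0 FB_le t1_le W1 W2 => f b *; lia.
apply: outcome_seq (raiseP valid_N pos_arc e_vw fr F_slots n_fuel) _.
move=> t2 [[? ?] N1] [raised_N1 t2_le].
apply: outcome_seq (lowerP valid_N pos_arc e_vw fr F_slots n_fuel raised_N1) _.
move=> t3 [[? ?] N2] [renum t3_le]; apply: outcome_ret.
right; exists F, B, c, a; split=> //; rewrite D_E in t1_le *.
move: (null_weight _ _) (null_weight _ _) t2_le t3_le W1 W2 => X1 X2 t2_le t3_le W1 W2.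
move: (size F) (size B) F_gt0 B_gt0 FB_le t1_le t2_le t3_le W1 W2 => f b *; lia.
Qed.

(** * The gain of a search *)

Lemma topological_connect n (e : rel 'I_n) p x y :
  is_topological e p -> connect e x y -> p x <= p y.
Proof.
move=> topo /connectP[s + ->]; elim: s x => //= z s IH x /andP[/topo xz /IH].
by apply: leq_trans; apply: ltnW.
Qed.

Definition connected_pairs {n : nat} (e : rel 'I_n) (P : pred ('I_n * 'I_n)) :=
  #|[set p | connect e p.1 p.2 && P p]|.

Lemma connected_pairs_mono n (e e' : rel 'I_n) P :
  subrel e e' -> connected_pairs e P <= connected_pairs e' P.
Proof.
move=> ee'; apply/subset_leq_card/subsetP => p; rewrite !inE => /andP[+ ->].
rewrite andbT; apply: connect_sub => x y /ee'; exact: connect1.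
Qed.

Lemma connected_pairs_new n (e e' : rel 'I_n) (P : pred ('I_n * 'I_n)) F B :
  subrel e e' -> uniq F -> uniq B ->
  (forall u z, u \in F -> z \in B ->
     [/\ connect e' z u, ~~ connect e z u & P (z, u)]) ->
  connected_pairs e P + size F * size B <= connected_pairs e' P.
Proof.
move=> ee' uF uB new; rewrite /connected_pairs.
set X := [set p | _]; pose Y := setX [set z in B] [set u in F].
have -> : size F * size B = #|Y|.
  by rewrite cardsX !cardsE (card_uniqP uF) (card_uniqP uB) mulnC.
rewrite -cardsUI (_ : X :&: Y = set0) ?cards0 ?addn0.
  apply/subset_leq_card/subsetP => -[z u]; rewrite !inE /=.
  case/orP=> [/andP[zu ->]|/andP[zB uF']].
    by rewrite andbT; apply: connect_sub zu => x y /ee'; exact: connect1.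
  by have [-> _ ->] := new u z uF' zB.
apply/setP => -[z u]; rewrite !inE /=; apply/negP => /andP[/andP[zu _] /andP[zB uF']].
by have [_ /negP] := new u z uF' zB.
Qed.

(** The sum [S], whose second factor [p] will be the positions at the end of the run. *)
Definition moment {n : nat} (p : 'I_n -> nat) (N : numbering n) : nat :=
  \sum_x position N x * p x.

Lemma valid_sum n (N N' : numbering n) :
  valid_numbering N -> valid_numbering N' ->
  \sum_x position N x = \sum_x position N' x.
Proof.
have sumE M : \sum_x position M x = \sum_(k <- map (position M) (enum 'I_n)) k.
  by rewrite big_map big_enum.
move=> /valid_positions vN /valid_positions vN'; rewrite !sumE.
by rewrite (perm_big _ vN) (perm_big _ vN').
Qed.

(** Both numberings have the same sum, so [p] may be shifted by any constant [q]. The terms stand on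
    the sides where no subtraction occurs. *)
Lemma moment_gain n (N N' : numbering n) (p : 'I_n -> nat) q (f : 'I_n -> nat) :
  valid_numbering N -> valid_numbering N' ->
  (forall x, position N x * p x + position N' x * q + f x <=
             position N' x * p x + position N x * q) ->
  moment p N + \sum_x f x <= moment p N'.
Proof.
move=> vN vN' H.
have : \sum_x (position N x * p x + position N' x * q + f x) <=
       \sum_x (position N' x * p x + position N x * q) by apply: leq_sum.
rewrite !big_split /= -!big_distrl /= (valid_sum vN vN') /moment.
by rewrite addnAC leq_add2r.
Qed.

Section Step.

Variables (n : nat) (e e' : rel 'I_n) (N N' : numbering n) (v w : 'I_n).
Variables (F B : seq 'I_n) (c : nat) (a : array 'I_n) (p : 'I_n -> nat).
Hypothesis valid_N : valid_numbering N.
Hypothesis fr : frontier e' N v w F B c c a.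
Hypothesis rn : renumbered e' N v w F B c N'.
Hypothesis sub_e : subrel e e'.
Hypothesis e'_vw : e' v w.
Hypothesis pos_e : is_topological e (position N).
Hypothesis p_e' : is_topological e' p.

Local Notation pos := (position N).
Local Notation pos' := (position N').

Lemma F_uniq : uniq F.
Proof. by apply: (pairwise_uniq _ (frontier_increasing fr)) => x; rewrite ltnn. Qed.

Lemma B_uniq : uniq B.
Proof. by apply: (pairwise_uniq _ (frontier_decreasing fr)) => x; rewrite ltnn. Qed.

Lemma new_pair u z : u \in F -> z \in B -> connect e' z u /\ ~~ connect e z u.
Proof.
move=> uF zB; have [_ wu] := frontier_forward fr uF.
have [_ zv] := frontier_backward fr zB; split.
  exact: connect_trans zv (connect_trans (connect1 e'_vw) wu).
apply/negP => /(topological_connect pos_e).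
by have := frontier_apart fr uF zB; lia.
Qed.

Lemma step_related :
  connected_pairs e predT + size F * size B <= connected_pairs e' predT.
Proof.
apply: connected_pairs_new F_uniq B_uniq _ => // u z uF zB.
by have [? ?] := new_pair uF zB; split.
Qed.

Variable T : nat.

Definition near_F (u : 'I_n) := p u < p v + T.
Definition near_B (z : 'I_n) := p w < p z + T.
Definition near_pair : pred ('I_n * 'I_n) := fun q => p q.2 < p q.1 + 2 * T.

(** With [p] shifted by [p v] no vertex contributes negatively: those that rise have
    [p x >= p w > p v], those that fall have [p x <= p v]. A member of [F] that is not near rises by
    at least [c - pos x], and each unit is worth at least [T]. *)
Lemma gain_F :
  moment p N + T * \sum_(x <- F | ~~ near_F x) (c - pos x) <= moment p N'.
Proof.
rewrite -big_filter big_uniq ?filter_uniq ?F_uniq // big_mkcond big_distrr /=.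
apply: (@moment_gain _ _ _ _ (p v)) => //; first exact: renumbered_valid rn.
move=> x; have p_vw := p_e' e'_vw.
have up : pos x < pos' x -> p w <= p x.
  by move/(renumbered_up rn)/(topological_connect p_e').
have down : pos' x < pos x -> p x <= p v.
  by move/(renumbered_down rn)/(topological_connect p_e').
have xF : x \in F -> pos x <= c <= pos' x.
  move=> xF; rewrite (renumbered_F rn xF).
  by have [->] := frontier_forward fr xF.
rewrite mem_filter /near_F; case: ifP => [/andP[far /xF x_c]|_].
  rewrite -leqNgt in far.
  have [d Ed] : exists d, pos' x = pos x + d by exists (pos' x - pos x); lia.
  have [g Eg] : exists g, p x = p v + T + g by exists (p x - p v - T); lia.
  have : T * (c - pos x) <= T * d by rewrite leq_mul2l; lia.
  rewrite Ed Eg; nia.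
rewrite muln0 addn0.
have [lt|lt|->//] := ltngtP (pos x) (pos' x).
- have [d Ed] : exists d, pos' x = pos x + d by exists (pos' x - pos x); lia.
  have [g Eg] : exists g, p x = p v + g by exists (p x - p v); have := up lt; lia.
  rewrite Ed Eg; nia.
- have [d Ed] : exists d, pos x = pos' x + d by exists (pos x - pos' x); lia.
  have [g Eg] : exists g, p v = p x + g by exists (p v - p x); have := down lt; lia.
  rewrite Ed Eg; nia.
Qed.

(** The shift is now by [p w], so that the fall of a member of [B] that is not near is worth at
    least [T] per unit. *)
Lemma gain_B :
  moment p N + T * \sum_(x <- B | ~~ near_B x) (pos x - c) <= moment p N'.
Proof.
rewrite -big_filter big_uniq ?filter_uniq ?B_uniq // big_mkcond big_distrr /=.
apply: (@moment_gain _ _ _ _ (p w)) => //; first exact: renumbered_valid rn.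
move=> x; have p_vw := p_e' e'_vw.
have up : pos x < pos' x -> p w <= p x.
  by move/(renumbered_up rn)/(topological_connect p_e').
have down : pos' x < pos x -> p x <= p v.
  by move/(renumbered_down rn)/(topological_connect p_e').
have xB : x \in B -> pos' x <= c <= pos x.
  move=> xB; rewrite (renumbered_B rn xB).
  by have [->] := frontier_backward fr xB.
rewrite mem_filter /near_B; case: ifP => [/andP[far /xB x_c]|_].
  rewrite -leqNgt in far.
  have [d Ed] : exists d, pos x = pos' x + d by exists (pos x - pos' x); lia.
  have [g Eg] : exists g, p w = p x + T + g by exists (p w - p x - T); lia.
  have : T * (pos x - c) <= T * d by rewrite leq_mul2l; lia.
  rewrite Ed Eg; nia.
rewrite muln0 addn0.
have [lt|lt|->//] := ltngtP (pos x) (pos' x).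
- have [d Ed] : exists d, pos' x = pos x + d by exists (pos' x - pos x); lia.
  have [g Eg] : exists g, p x = p w + g by exists (p x - p w); have := up lt; lia.
  rewrite Ed Eg; nia.
- have [d Ed] : exists d, pos x = pos' x + d by exists (pos x - pos' x); lia.
  have [g Eg] : exists g, p w = p x + g by exists (p w - p x); have := down lt; lia.
  rewrite Ed Eg; nia.
Qed.

Lemma near_sum (s : seq 'I_n) (near : pred 'I_n) (f : 'I_n -> nat) :
  (forall x, f x <= n) ->
  \sum_(x <- s) f x <= \sum_(x <- s | ~~ near x) f x + n * count near s.
Proof.
move=> f_n; rewrite (bigID near) /= addnC leq_add2l -sum1_count big_distrr /=.
by apply: leq_sum => x _; rewrite muln1.
Qed.

(** A near member of either queue forces [p w < p v + T], which makes both [w] and [v] near. Hence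
    the two counts are both zero or both positive, and their sum is at most twice their product. *)
Lemma near_count :
  count near_F F + count near_B B +
    2 * connected_pairs e near_pair <= 2 * connected_pairs e' near_pair.
Proof.
have [wF vB] := frontier_ends fr; have p_vw := p_e' e'_vw.
have pF u : u \in F -> p w <= p u.
  by case/(frontier_forward fr) => _ /(topological_connect p_e').
have pB z : z \in B -> p z <= p v.
  by case/(frontier_backward fr) => _ /(topological_connect p_e').
have new : connected_pairs e near_pair + count near_F F * count near_B B <=
           connected_pairs e' near_pair.
  rewrite -!size_filter; apply: connected_pairs_new => //.
  - by rewrite filter_uniq ?F_uniq.
  - by rewrite filter_uniq ?B_uniq.
  move=> u z; rewrite !mem_filter => /andP[nu uF] /andP[nz zB].
  have [? ?] := new_pair uF zB; split=> //.
  (* The gap is below [2 * T] because [p v < p w]. *)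
  by move: nu nz; rewrite /near_F /near_B /near_pair /=; lia.
have both : (0 < count near_F F) = (0 < count near_B B).
  rewrite -!has_count; apply/hasP/hasP => -[x xs].
    move=> nx; exists v => //; move: nx; rewrite /near_F /near_B.
    by have := pF x xs; lia.
  move=> nx; exists w => //; move: nx; rewrite /near_F /near_B.
  by have := pB x xs; lia.
suff : count near_F F + count near_B B <= 2 * (count near_F F * count near_B B).
  by move: new; lia.
by case: (count near_F F) (count near_B B) both => [|f] [|b] // _; nia.
Qed.

(** The moment is doubled because [gain_F] and [gain_B] each use its whole increase. The near
    members, at most [n] each, are paid for by the new near pairs. *)
Lemma step_spread :
  T * spread N F B c c + 2 * moment p N + T * n * (2 * connected_pairs e near_pair)
  <= 2 * moment p N' + T * n * (2 * connected_pairs e' near_pair).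
Proof.
have pos_n x : pos x <= n by have := valid_N.1 x; lia.
have c_n : c <= n by have [] := frontier_bounds fr.
have sF : \sum_(x <- F) (c - pos x) <=
    \sum_(x <- F | ~~ near_F x) (c - pos x) + n * count near_F F.
  by apply: near_sum => x; have := pos_n x; lia.
have sB : \sum_(x <- B) (pos x - c) <=
    \sum_(x <- B | ~~ near_B x) (pos x - c) + n * count near_B B.
  by apply: near_sum => x; have := pos_n x; lia.
have gF := gain_F; have gB := gain_B; have nc := near_count.
rewrite /spread.
move: (\sum_(x <- F | ~~ near_F x) _) (\sum_(x <- B | ~~ near_B x) _) sF sB gF gB.
move: (\sum_(x <- F) _) (\sum_(x <- B) _) => SF SB FF FB sF sB gF gB.
have : T * (SF + SB) <= T * (FF + FB) + T * n * (count near_F F + count near_B B).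
  by rewrite -mulnA -mulnDr leq_mul2l; apply/orP; right; lia.
have : T * n * (count near_F F + count near_B B) +
       T * n * (2 * connected_pairs e near_pair) <=
       T * n * (2 * connected_pairs e' near_pair).
  by rewrite -mulnDr leq_mul2l nc orbT.
rewrite mulnDr; move: (T * n * _) (T * n * _) (T * n * _) => X1 X2 X3.
rewrite !mulnDr; lia.
Qed.

End Step.

(** * The whole run *)

Lemma uniq_size_ord n (s : seq 'I_n) : uniq s -> size s <= n.
Proof. by move/card_uniqP <-; have := max_card (mem s); rewrite card_ord. Qed.

(** [88 = 22 * 4]: each of [1], the two halves of the spread and the product is at most [n ^ 2]. *)
Lemma search_run_crude n (e : rel 'I_n) N v w t r :
  valid_numbering N -> search_run e N v w t r -> t <= 88 * n ^ 2.
Proof.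
move=> vN [F [B [c [a [fr t_le _]]]]].
have n_gt0 : 0 < n := leq_ltn_trans (leq0n v) (ltn_ord v).
have pos_n x : position N x <= n by have := vN.1 x; lia.
have c_n : c <= n by have [] := frontier_bounds fr.
have sF := uniq_size_ord (F_uniq fr); have sB := uniq_size_ord (B_uniq fr).
have FB : size F * size B <= n ^ 2 by rewrite -mulnn leq_mul.
have bound (s : seq 'I_n) (f : 'I_n -> nat) :
    size s <= n -> (forall x, f x <= n) -> \sum_(x <- s) f x <= n ^ 2.
  move=> s_n f_n; apply: (@leq_trans (\sum_(x <- s) n)); first exact: leq_sum.
  by rewrite big_const_seq iter_addn_0 count_predT -mulnn leq_mul2l s_n orbT.
have D_le : spread N F B c c <= n ^ 2 + n ^ 2.
  by apply: leq_add; apply: bound => // x; have := pos_n x; lia.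
have : 0 < n ^ 2 by rewrite expn_gt0 n_gt0.
by move: (n ^ 2) (size F * size B) FB D_le t_le => *; lia.
Qed.

Lemma arc_rel_rcons n (arcs : seq ('I_n * 'I_n)) v w x y :
  arc_rel (rcons arcs (v, w)) x y = ((x, y) == (v, w)) || arc_rel arcs x y.
Proof. by rewrite /arc_rel mem_rcons inE. Qed.

(* A search increases it by at least [T] times its cost, up to a constant
   factor and a term [T]. *)
Definition potential {n : nat} (T : nat) (p : 'I_n -> nat) (N : numbering n)
    (e : rel 'I_n) : nat :=
  2 * moment p N + T * n * (2 * connected_pairs e (near_pair p T)) +
  T * connected_pairs e predT.

Lemma potential_mono n T p (N : numbering n) (e e' : rel 'I_n) :
  subrel e e' -> potential T p N e <= potential T p N e'.
Proof.
move=> ee'; rewrite /potential !leq_add // !leq_mul //;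
  exact: connected_pairs_mono.
Qed.

(** The potential refers to a numbering [M] known only at the end of the run, so [M] and its graph
    [e] are produced by the induction. They are those in force before the last addition, which is
    charged [88 * n ^ 2] separately since it may create a cycle. *)
Lemma add_arcsP n T fuel (added todo : seq ('I_n * 'I_n)) (N : numbering n) :
  n.+1 < fuel -> valid_numbering N ->
  is_topological (arc_rel added) (position N) ->
  all (fun a => a.1 != a.2) todo ->
  (forall k, k < size todo -> acyclic (arc_rel (added ++ take k todo))) ->
  outcome (add_arcs fuel added todo N) (fun t _ =>
    exists (M : numbering n) (e : rel 'I_n),
    [/\ valid_numbering M, subrel (arc_rel added) e,
        is_topological e (position M) &
        T * t + 23 * potential T (position M) N (arc_rel added) <=
        23 * potential T (position M) M e +
        T * (23 * size todo + 88 * n ^ 2)]).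
Proof.
move=> n_fuel; elim: todo added N => [|[v w] todo IH] added N vN topo.
  by move=> _ _; apply: outcome_ret; exists N, (arc_rel added); split=> //; lia.
move=> /= /andP[v_w loopfree] ac; apply: outcome_op_bind.
pose added' := rcons added (v, w); rewrite -/added'.
have sub : subrel (arc_rel added) (arc_rel added').
  by move=> x y xy; rewrite arc_rel_rcons xy orbT.
have vw : arc_rel added' v w by rewrite arc_rel_rcons eqxx.
have pos_arc x y : arc_rel added' x y -> (x, y) != (v, w) ->
    position N x < position N y.
  by rewrite arc_rel_rcons => /orP[/eqP -> /eqP //|/topo].
have n_gt0 : 0 < n ^ 2 by rewrite expn_gt0 (leq_ltn_trans (leq0n v) (ltn_ord v)).
apply: outcome_seq (topological_searchP vN vw v_w pos_arc n_fuel) _ => t r run.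
have t_le : t <= 88 * n ^ 2.
  by case: run => [[_ _ ->]|/(search_run_crude vN)] //; lia.
(* If the run ends with this addition, the numbering and the graph before it serve as [M] and [e];
   [s] stands for the update of the matrix. *)
have stop s : s <= 1 -> exists (M : numbering n) (e : rel 'I_n),
    [/\ valid_numbering M, subrel (arc_rel added) e,
        is_topological e (position M) &
        T * (t + s) + 23 * potential T (position M) N (arc_rel added) <=
        23 * potential T (position M) M e +
        T * (23 * (size todo).+1 + 88 * n ^ 2)].
  move=> s1; exists N, (arc_rel added); split=> //.
  by rewrite addnC leq_add2l leq_mul2l; apply/orP; right; lia.
case: r run => [N'|] run; last first.
  by apply: outcome_ret; have := stop 1 isT; rewrite addn0 addn1.
have [todo0|todo_neq0] := eqVneq todo [::].
  by rewrite todo0 /=; apply: outcome_ret; have := stop 1 isT; rewrite todo0 addn0 addn1.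
have ac' k : k < size todo -> acyclic (arc_rel (added' ++ take k todo)).
  by move=> k_todo; have := ac k.+1 k_todo; rewrite /= cat_rcons.
have ac_added' : acyclic (arc_rel added').
  have := ac' 0; rewrite take0 cats0; apply.
  by case: (todo) todo_neq0.
have [vN' topo'] : valid_numbering N' /\
    is_topological (arc_rel added') (position N').
  case: run => [[v_lt_w [->] _]|[F [B [c [a [_ _ rn]]]]]].
    split=> // x y; rewrite arc_rel_rcons => /orP[/eqP[-> ->] //|/topo//].
  by split; [exact: renumbered_valid rn | exact: renumbered_arc rn ac_added'].
apply: outcome_imp (IH added' N' vN' topo' loopfree ac') _ => s _.
move=> [M [e [vM sub_e topo_M s_le]]]; exists M, e; split=> //.
  by move=> x y /sub /sub_e.
have topo_M' : is_topological (arc_rel added') (position M).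
  by move=> x y /sub_e /topo_M.
(* The [23] is [22] for the search and [1] for the update of the matrix. *)
suff step : T * t.+1 + 23 * potential T (position M) N (arc_rel added) <=
    23 * T + 23 * potential T (position M) N' (arc_rel added').
  have : T * (t.+1 + s) = T * t.+1 + T * s by rewrite mulnDr.
  have : T * (23 * (size todo).+1 + 88 * n ^ 2) =
         T * (23 * size todo + 88 * n ^ 2) + 23 * T by nia.
  rewrite -addSn; move=> -> ->; lia.
case: run => [[_ [->] ->]|[F [B [c [a [fr run_t rn]]]]]].
  have := potential_mono T (position M) N sub; nia.
have spr := step_spread vN fr rn sub vw topo topo_M' T.
have rel_ := step_related fr sub vw topo.
rewrite /potential; move: spr.
move: (T * n * _) (T * n * _) => X1 X2 spr.
have t1_le : T * t.+1 <= T * (23 * (1 + spread N F B c c + size F * size B)).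
  by rewrite leq_mul2l; apply/orP; right; lia.
have : T * connected_pairs (arc_rel added) predT + T * (size F * size B) <=
       T * connected_pairs (arc_rel added') predT.
  by rewrite -mulnDr leq_mul2l rel_ orbT.
have : T * (23 * (1 + spread N F B c c + size F * size B)) =
       23 * (T + T * spread N F B c c + T * (size F * size B)) by nia.
move: t1_le spr; move: (T * (23 * _)) (T * spread _ _ _ _ _) (T * (size F * size B)).
move: (T * connected_pairs _ _) (T * connected_pairs _ _) (T * t.+1).
move: (moment _ _) (moment _ _) => *; lia.
Qed.

(** A connected pair is determined by its first member and its gap, which is a natural number below
    [2 * T]. *)
Lemma near_pairs_le n (M : numbering n) (e : rel 'I_n) T :
  valid_numbering M -> is_topological e (position M) ->
  connected_pairs e (near_pair (position M) T) <= n * (2 * T).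
Proof.
move=> vM topo.
pose f (q : 'I_n * 'I_n) := (q.1, position M q.2 - position M q.1).
have -> : n * (2 * T) = size [seq (x, d) | x <- enum 'I_n, d <- iota 0 (2 * T)].
  by rewrite size_allpairs size_enum_ord size_iota.
rewrite /connected_pairs cardE -(size_map f); apply: uniq_leq_size.
  rewrite map_inj_in_uniq ?enum_uniq // => -[x y] [x' y'].
  rewrite !mem_enum !inE /= => /andP[xy _] /andP[xy' _] [xx' d]; rewrite -xx' in xy' d *.
  suff -> : y = y' by []; apply: (valid_position_inj vM).
  by have := topological_connect topo xy; have := topological_connect topo xy'; lia.
move=> q /mapP[[x y]]; rewrite mem_enum inE /near_pair /= => /andP[xy near] ->.
apply/allpairsP; exists (x, position M y - position M x).
rewrite /= mem_enum mem_iota; split=> //.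
by have := topological_connect topo xy; lia.
Qed.

Lemma related_le n (e : rel 'I_n) P : connected_pairs e P <= n ^ 2.
Proof.
have := max_card (mem [set p | connect e p.1 p.2 && P p]).
by rewrite card_prod !card_ord mulnn.
Qed.

Lemma moment_le n (M : numbering n) :
  valid_numbering M -> moment (position M) M <= n ^ 3.
Proof.
move=> vM; rewrite /moment; apply: (@leq_trans (\sum_(x < n) n * n)).
  by apply: leq_sum => x _; apply: leq_mul; have := vM.1 x; lia.
by rewrite sum_nat_const card_ord !expnS expn0 muln1.
Qed.

Lemma total_time_bound n m T (N : numbering n) (arcs : m.-tuple ('I_n * 'I_n)) :
  0 < T -> n <= T ^ 2 -> valid_numbering N -> incremental arcs ->
  exists t, total_time N arcs t /\ t <= 364 * (n ^ 2 * T).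
Proof.
move=> T_gt0 n_T vN [uniq_arcs loopfree ac].
have topo : is_topological (arc_rel [::]) (position N) by move=> x y.
have := add_arcsP T (ltnSn n.+1) vN topo loopfree ac.
case/outcomeW => t [r [runE [M [e [vM _ topo_M t_le]]]]].
exists t; split; first by exists n.+2, r.
have size_le : size arcs <= n ^ 2.
  rewrite -mulnn; move/card_uniqP: uniq_arcs => <-.
  by have := max_card (mem (tval arcs)); rewrite card_prod !card_ord.
have mom := moment_le vM; have near := near_pairs_le T vM topo_M.
have rel_ := related_le e predT.
have n3 : n ^ 3 <= n ^ 2 * T ^ 2 by rewrite expnSr leq_mul2l n_T orbT.
have nearE : T * n * (2 * connected_pairs e (near_pair (position M) T)) <=
             4 * (n ^ 2 * T ^ 2).
  apply: (@leq_trans (T * n * (2 * (n * (2 * T))))).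
    by rewrite !leq_mul2l near !orbT.
  by rewrite -!mulnn; nia.
have relE : T * connected_pairs e predT <= n ^ 2 * T ^ 2.
  rewrite mulnC leq_mul // -mulnn leq_pmulr //.
have lastE : T * (23 * size arcs + 88 * n ^ 2) <= 111 * (n ^ 2 * T ^ 2).
  apply: (@leq_trans (T * (111 * n ^ 2))); first by rewrite leq_mul2l; lia.
  by rewrite -[T ^ 2]mulnn; nia.
(* In units of [n ^ 2 * T ^ 2] the terms of the potential are at most [2], [4] and [1], and the
   total [23 * 7 + 111 = 272] is below [364]. *)
rewrite -(leq_pmul2l T_gt0).
have -> : T * (364 * (n ^ 2 * T)) = 364 * (n ^ 2 * T ^ 2) by rewrite -[T ^ 2]mulnn; nia.
move: t_le; rewrite /potential.
move: (n ^ 2 * T ^ 2) n3 nearE relE lastE => Z.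
move: (T * n * _) (T * connected_pairs _ _) (T * (_ + _)) => *; lia.
Qed.

(** * Real exponents and the final bound *)

Import Order.TTheory GRing.Theory Num.Theory.
Local Open Scope ring_scope.

(** For the least [T] with [n <= T ^ 2], both [T.-1] and [1] are at most the square root of [n],
    whence the factor [2]. *)
Lemma nat_sqrt_bound (R : realType) (n : nat) :
  (0 < n)%N -> exists T : nat,
  [/\ (0 < T)%N, (n <= T ^ 2)%N & T%:R <= 2 * n%:R `^ (1 / 2) :> R].
Proof.
move=> n_gt0; have exT : exists T, (n <= T ^ 2)%N by exists n; rewrite -mulnn leq_pmull.
case: (ex_minnP exT) => T n_T min_T.
have T_gt0 : (0 < T)%N by case: T n_T {min_T} => //; case: (n) n_gt0.
exists T; split=> //.
have sqr_lt : (T.-1 ^ 2 <= n)%N.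
  rewrite leqNgt; apply/negP => /ltnW /min_T; lia.
have n1 : 1 <= n%:R `^ (1 / 2) :> R.
  rewrite mul1r powR12_sqrt ?ler0n // -[X in X <= _]sqrtr1 ler_sqrt ?ler1n //.
have T1 : T.-1%:R <= n%:R `^ (1 / 2) :> R.
  rewrite mul1r powR12_sqrt ?ler0n // -[X in X <= _]ger0_norm ?ler0n // -sqrtr_sqr.
  by rewrite ler_sqrt // -natrX ler_nat.
have -> : T%:R = T.-1%:R + 1 :> R by rewrite -[in LHS](prednK T_gt0) -addn1 natrD.
by rewrite mulr_natl mulr2n lerD.
Qed.

Theorem theorem5p6 (R : realType) :
  exists C : R, forall (n m : nat) (N : numbering n)
    (arcs : m.-tuple ('I_n * 'I_n)),
    valid_numbering N -> incremental arcs ->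
    exists t : nat,
      total_time N arcs t /\ t%:R <= C * (n%:R `^ (5 / 2)).
Proof.
(* [728 = 364 * 2], the factor [2] coming from the rounding of the square root. *)
exists 728%:R => n m N arcs vN inc.
(* For [n = 0] no positive [T] is at most twice the root of [n]; there [T = 1] already gives
   [t = 0]. *)
have [n0|n_gt0] := posnP n.
  have [|t [run t_le]] := total_time_bound (T := 1) isT _ vN inc; first by rewrite n0.
  exists t; split=> //; move: t_le; rewrite {1}n0 leqn0 => /eqP ->.
  by rewrite mulr_ge0 ?powR_ge0.
have [T [T_gt0 n_T T_le]] := nat_sqrt_bound R n_gt0.
have [t [run t_le]] := total_time_bound T_gt0 n_T vN inc.
exists t; split=> //.
apply: (@le_trans _ _ (364 * (n ^ 2 * T))%:R); first by rewrite ler_nat.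
have -> : 5 / 2 = 2%:R + 1 / 2 :> R by lra.
rewrite powRD ?powR_mulrn ?ler0n //; last by rewrite pnatr_eq0 -lt0n n_gt0 implybT.
rewrite natrM natrM natrX (_ : 728%:R = 364%:R * 2 :> R); last by rewrite -natrM.
rewrite -[X in _ <= X]mulrA ler_pM2l ?ltr0n // mulrCA ler_wpM2l ?exprn_ge0 ?ler0n //.
Qed.
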